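(* Let $d\le n$ be positive integers and $k$ an even integer. For a $k$-XOR instance $\Phi$ on $n$ variables with $m\ge1$ constraints on distinct tuples, define $$\widehat{\mathrm{sat}}:=\frac12+\frac{1}{2m}\|R^{\Phi,d}_{\mathrm{norm}}\|^{1/d}\Big(\frac{(kd/2+n-1)!}{(n-1)!}\Big)^{1/d}.$$ Then (i) for any such instance $\Phi$ and any $x\in\{\pm1\}^n$, $|\mathrm{sat}_\Phi(x)-\frac12|\le\widehat{\mathrm{sat}}-\frac12$. (ii) There is an absolute constant $c>0$ such that if $\Phi$ is a random $k$-XOR instance with probability $p$ and $p\,d^{k/2-1}n^{k/2}>1$, then with probability at least $1-O(n^{-1})$, $$\widehat{\mathrm{sat}}-\frac12\le c\cdot\frac{\log n}{\sqrt{d^{k/2-1}n^{k/2}p}}\cdot\frac{e^{3k/4}(k/2+1)^{k/2}}{(k/2)^{k/4}}.$$ In particular, for fixed $k$, whenever $n^{k-1}p=\omega\big((n/d)^{k/2-1}\log^2n\big)$, with high probability $\widehat{\mathrm{sat}}=\frac12+o(1)$, so that $\mathrm{sat}_\Phi(x)\le\frac12+o(1)$ is certified for all $x\in\{\pm1\}^n$.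
   Context: A $k$-XOR instance $\Phi$ is a set of constraints $C_{S_1},\dots,C_{S_m}$ with distinct $S_a=(s_1,\dots,s_k)\in[n]^k$, $C_S$ being $\prod_{i=1}^kx_{s_i}=\eta_S$ with $\eta_S\in\{\pm1\}$; $\mathrm{sat}_\Phi(x)$ is the fraction of constraints satisfied by $x$. Random $k$-XOR with probability $p$: each of the $n^k$ tuples is independently included with probability $p$, with i.i.d. uniform signs $\eta_S$. Constraint tensor: $T_S=\eta_S$ if $S$ is a constraint tuple, else $0$. $\|\cdot\|$ is the spectral norm; $\log$ natural. $M^\Phi$ is the $n^{k/2}\times n^{k/2}$ matrix indexed by $[n]^{k/2}$ with $M^\Phi_{U,V}=T_{(U,V)}$ (concatenation); $S^\Phi=\frac12(M^\Phi+(M^\Phi)^\top)$. $S^{\Phi,d}$ is indexed by $[n]^{kd/2}$, tuples written as concatenations $(U_1,\dots,U_d)$ of blocks in $[n]^{k/2}$, with $S^{\Phi,d}_{(U_1,\dots,U_d),(V_1,\dots,V_d)}=\prod_{s=1}^dS^\Phi_{U_s,V_s}$. For $I=(i_1,\dots,i_q)$ and $\pi\in\mathbb{S}_q$, $\pi(I)=(i_{\pi(1)},\dots,i_{\pi(q)})$; $R^{\Phi,d}_{I,J}=\frac{1}{((kd/2)!)^2}\sum_{\pi,\sigma\in\mathbb{S}_{kd/2}}S^{\Phi,d}_{\pi(I),\sigma(J)}$. $\mathrm{hist}(I)=(\alpha_1,\dots,\alpha_n)$ with $\alpha_i$ the number of occurrences of $i$ in $I$, $\mathrm{hist}(I)!=\prod_i\alpha_i!$.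 $D_{\mathrm{hist}}$ is diagonal with $(I,I)$ entry $\sqrt{\mathrm{hist}(I)!}$, and $R^{\Phi,d}_{\mathrm{norm}}=D_{\mathrm{hist}}^{-1}R^{\Phi,d}D_{\mathrm{hist}}^{-1}$. *)

(* Defs.v *)
From HB Require Import structures.
From mathcomp Require Import all_boot all_order all_fingroup all_algebra.
From mathcomp Require Import boolp classical_sets reals sequences exp.
Set Implicit Arguments. Unset Strict Implicit. Unset Printing Implicit Defensive.
Import Order.TTheory GRing.Theory Num.Theory.
Local Open Scope ring_scope.

Section KXOR.
Variable R : realType.

(* A k-XOR instance on n variables is given by its constraint tensor
   T : [n]^k -> {-1,0,1}; constraint tuples are those S with T S != 0. *)
Definition is_instance (n k : nat) (T : {ffun k.-tuple 'I_n -> R}) : Prop :=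
  forall S, T S = 0 \/ T S = 1 \/ T S = -1.

Definition nconstr (n k : nat) (T : {ffun k.-tuple 'I_n -> R}) : nat :=
  #|[set S | T S != 0]|.

Definition sat (n k : nat) (T : {ffun k.-tuple 'I_n -> R}) (x : 'I_n -> R) : R :=
  (#|[set S | (T S != 0) && (\prod_(i < k) x (tnth S i) == T S)]|)%:R
    / (nconstr T)%:R.

Definition lookup (n k : nat) (T : {ffun k.-tuple 'I_n -> R}) (s : seq 'I_n) : R :=
  if (insub s : option (k.-tuple 'I_n)) is Some t then T t else 0.

Definition SPhi (n k : nat) (T : {ffun k.-tuple 'I_n -> R}) (U V : seq 'I_n) : R :=
  (lookup T (U ++ V) + lookup T (V ++ U)) / 2.

Definition blk (n h s : nat) (I : seq 'I_n) : seq 'I_n := take h (drop (s * h) I).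

Definition SPhid (n k d : nat) (T : {ffun k.-tuple 'I_n -> R})
    (I J : (k./2 * d).-tuple 'I_n) : R :=
  \prod_(s < d) SPhi T (blk k./2 s I) (blk k./2 s J).

Definition permt (n q : nat) (pi : 'S_q) (I : q.-tuple 'I_n) : q.-tuple 'I_n :=
  [tuple tnth I (pi j) | j < q].

Definition RPhid (n k d : nat) (T : {ffun k.-tuple 'I_n -> R})
    (I J : (k./2 * d).-tuple 'I_n) : R :=
  (((k./2 * d)`!)%:R ^+ 2)^-1 *
  \sum_(pi : 'S_(k./2 * d)) \sum_(sg : 'S_(k./2 * d))
     SPhid T (permt pi I) (permt sg J).

Definition histfact (n : nat) (I : seq 'I_n) : nat :=
  \prod_(i : 'I_n) (count_mem i I)`!.

Definition RPhid_norm (n k d : nat) (T : {ffun k.-tuple 'I_n -> R})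
    (I J : (k./2 * d).-tuple 'I_n) : R :=
  (Num.sqrt (histfact I)%:R)^-1 * RPhid T I J * (Num.sqrt (histfact J)%:R)^-1.

Definition spec_norm (I : finType) (A : I -> I -> R) : R :=
  sup [set r : R | exists x : I -> R,
         \sum_(i : I) x i ^+ 2 = 1 /\
         r = Num.sqrt (\sum_(i : I) (\sum_(j : I) A i j * x j) ^+ 2)].

Definition sathat (n k d : nat) (T : {ffun k.-tuple 'I_n -> R}) : R :=
  1 / 2 + (2 * (nconstr T)%:R)^-1
          * (spec_norm (@RPhid_norm n k d T) `^ (d%:R^-1))
          * (((k./2 * d + n - 1)`!)%:R / ((n - 1)`!)%:R) `^ (d%:R^-1).

(* Random k-XOR instance with probability p: each tuple independently
   absent (None, prob 1-p) or present with sign +1/-1 (Some true/false,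
   prob p/2 each). *)
Definition tensor_of (n k : nat) (w : {ffun k.-tuple 'I_n -> option bool})
  : {ffun k.-tuple 'I_n -> R} :=
  [ffun S => match w S with None => 0 | Some b => if b then 1 else -1 end].

Definition weight (n k : nat) (p : R) (w : {ffun k.-tuple 'I_n -> option bool}) : R :=
  \prod_(S : k.-tuple 'I_n) (match w S with None => 1 - p | Some _ => p / 2 end).

Definition Prob (n k : nat) (p : R) (E : {ffun k.-tuple 'I_n -> R} -> bool) : R :=
  \sum_(w : {ffun k.-tuple 'I_n -> option bool}) weight p w * (E (tensor_of w))%:R.

Definition bound_ii (n k d : nat) (p : R) : R :=
  ln (n%:R) / Num.sqrt ((d%:R) ^+ (k./2 - 1) * (n%:R) ^+ k./2 * p)
  * (expR (3 * k%:R / 4) * (k%:R / 2 + 1) ^+ k./2 / ((k%:R / 2) `^ (k%:R / 4))).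

End KXOR.

(* Main.v *)
Require Import Defs.
From HB Require Import structures.
From mathcomp Require Import all_boot all_order all_fingroup all_algebra.
From mathcomp Require Import boolp classical_sets reals sequences exp.
From mathcomp Require Import ring lra zify.
Import Order.TTheory GRing.Theory Num.Theory.
Local Open Scope ring_scope.

(** For part (i), [v_I = sqrt (hist(I)!) x^I] has squared norm
    [sum_I hist(I)! = (q+n-1)!/(n-1)!] with [q = kd/2], and the quadratic form of
    [R_norm] at [v] is [(sum_S T_S x^S)^d = (m (2 sat - 1))^d].

    Part (ii) is a trace bound [||R_norm||^(2l) <= tr R_norm^(2l)] with [l] a power of two
    between [log n] and [2 log n].  Conjugating by [D_hist], the trace is a sum over closed
    walks: at [I], choose an arrangement of [I], cut it into [d] blocks [U_s], and read
    a constraint [(U_s, V_s)] for each.  A monomial in the constraints has mean [0] unless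
    every exponent is even, in which case it involves [u <= l d] distinct constraints and
    its mean is [p^u <= lam^(-l d) (lam p)^u] for every [lam <= 1].  Constraints are thus
    revealed one at a time, a fresh one costing [lam p] and a repeated one costing [1]:
    since a block [U_s] with entries in [I] can be chosen in at most [q^(k/2)] ways, each of
    the [2 l d] steps contributes a factor [lam p q^(k/2) n^(k/2) + 2 l d].  The choice
    [lam = d / (p q^(k/2) n^(k/2))] balances the two terms. *)

(** * Sums over tuples and histograms *)

Section TupleSums.
Variables (R : realType) (n : nat).
Implicit Types F : seq 'I_n -> R.

Definition sumt N F : R := \sum_(I : N.-tuple 'I_n) F I.

Lemma sumt0 F : sumt 0 F = F [::].
Proof.
by rewrite /sumt (big_pred1 [tuple]) //= => t; apply/esym/eqP/tuple0.
Qed.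

Lemma sumtS N F : sumt N.+1 F = \sum_(i < n) sumt N (fun s => F (i :: s)).
Proof.
rewrite /sumt pair_big /=.
rewrite (reindex (fun p : 'I_n * N.-tuple 'I_n => cons_tuple p.1 p.2)) //=.
exists (fun t : N.+1.-tuple 'I_n => (thead t, behead_tuple t)) => [[i t]|t] _ /=.
  by congr pair; apply: val_inj.
by rewrite [RHS]tuple_eta; apply: val_inj.
Qed.

Lemma eq_sumt N F G : (forall s, size s = N -> F s = G s) -> sumt N F = sumt N G.
Proof. by move=> FG; apply: eq_bigr => I _; rewrite FG ?size_tuple. Qed.

Lemma sumtD a b F :
  sumt (a + b) F = sumt a (fun u => sumt b (fun v => F (u ++ v))).
Proof.
elim: a F => [|a IH] F; first by rewrite sumt0.
by rewrite addSn !sumtS; apply: eq_bigr => i _; rewrite IH.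
Qed.

Lemma sumtZ N c F : sumt N (fun s => c * F s) = c * sumt N F.
Proof. by rewrite /sumt mulr_sumr. Qed.

Lemma sumtZr N c F : sumt N (fun s => F s * c) = sumt N F * c.
Proof. by rewrite /sumt mulr_suml. Qed.

Lemma sumt_exchange a b (F : seq 'I_n -> seq 'I_n -> R) :
  sumt a (fun u => sumt b (fun v => F u v)) =
  sumt b (fun v => sumt a (fun u => F u v)).
Proof. by rewrite /sumt exchange_big. Qed.

End TupleSums.

Section Hist.
Variables (R : realType) (n : nat).

Lemma histfact_gt0 (s : seq 'I_n) : (0 < histfact s)%N.
Proof. by rewrite /histfact prodn_gt0 // => i; rewrite fact_gt0. Qed.

Lemma histfact_cons i (s : seq 'I_n) :
  histfact (i :: s) = ((count_mem i s).+1 * histfact s)%N.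
Proof.
rewrite /histfact (bigD1 i) //= [in RHS](bigD1 i) //= eqxx add1n factS -mulnA.
by congr (_ * (_ * _))%N; apply: eq_bigr => j /negPf; rewrite eq_sym => ->.
Qed.

Lemma sum_count_mem (s : seq 'I_n) : (\sum_(i < n) count_mem i s)%N = size s.
Proof.
elim: s => [|x s IH] /=; first by rewrite big1.
rewrite big_split /= IH (bigD1 x) //= eqxx big1 ?addn0 // => i.
by rewrite eq_sym => /negPf->.
Qed.

(** Prepending [i] multiplies [histfact s] by one plus the multiplicity of [i] in [s]. Summed over
    [i], these factors give [size s + n], the next factor of the rising factorial. *)
Lemma sum_histfact q : (0 < n)%N ->
  sumt R n q (fun s => (histfact s)%:R) = ((q + n - 1)`!)%:R / ((n - 1)`!)%:R.
Proof.
move=> n0; have f0 : ((n - 1)`!)%:R != 0 :> R by rewrite pnatr_eq0 -lt0n fact_gt0.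
elim: q => [|q IH].
  rewrite sumt0 add0n divff // /histfact big1 //.
rewrite sumtS /sumt exchange_big /=.
under eq_bigr => s _.
  under eq_bigr => i _ do rewrite histfact_cons natrM.
  rewrite -mulr_suml -natr_sum.
  under eq_bigr => i _ do rewrite -addn1.
  rewrite big_split /= sum_count_mem size_tuple sum_nat_const card_ord muln1.
  over.
rewrite -mulr_sumr -[X in _ * X]/(sumt R n q (fun s => (histfact s)%:R)) IH mulrA -natrM.
have -> : (q.+1 + n - 1 = (q + n - 1).+1)%N by lia.
rewrite factS; have -> // : (q + n - 1).+1 = (q + n)%N by lia.
Qed.

(* A permutation in the fiber is, up to a fixed one, a stabilizer of [I], hence
   determined by its restrictions to the level sets of [I]. *)
Lemma card_perm_fiber q (I J : q.-tuple 'I_n) :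
  (#|[set s : 'S_q | permt s I == J]| <= histfact I)%N.
Proof.
have [->|[s0 s0P]] := set_0Vmem [set s : 'S_q | permt s I == J].
  by rewrite cards0.
pose B i := [set j | tnth I j == i].
have stab : (#|[set s : 'S_q | permt s I == J]|
             <= #|[set s : 'S_q | [forall j, tnth I (s j) == tnth I j]]|)%N.
  pose f (s : 'S_q) := (s0^-1 * s)%g.
  have fI : injective f by move=> s t /mulgI.
  rewrite -(card_imset _ fI); apply: subset_leq_card.
  apply/fintype.subsetP => _ /imsetP [s sP ->]; rewrite inE; apply/forallP => j.
  move: sP s0P; rewrite !inE => /eqP sE /eqP s0E.
  have E k : tnth I (s k) = tnth I (s0 k).
    by rewrite -s0E in sE; move: (congr1 (fun t => tnth t k) sE); rewrite !tnth_mktuple.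
  by rewrite permM E permKV.
apply: leq_trans stab _.
pose r (s : 'S_q) : {ffun 'I_n -> 'S_q} := [ffun i => restr_perm (B i) s].
have astab (s : 'S_q) i : [forall j, tnth I (s j) == tnth I j] -> s \in ('N(B i | 'P))%g.
  move=> /forallP sI; apply/astabsP => j /=.
  by rewrite !inE /aperm (eqP (sI j)).
have rI : {in [set s : 'S_q | [forall j, tnth I (s j) == tnth I j]] &, injective r}.
  move=> s t; rewrite !inE => sI tI rst; apply/permP => j.
  have jB : j \in B (tnth I j) by rewrite inE.
  rewrite -(restr_permE (astab _ _ sI) jB) -(restr_permE (astab _ _ tI) jB).
  by move/ffunP: rst => /(_ (tnth I j)); rewrite !ffunE => ->.
rewrite -(card_in_imset rI).
have sub : r @: [set s : 'S_q | [forall j, tnth I (s j) == tnth I j]]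
     \subset family (fun i => perm_on (B i)).
  apply/fintype.subsetP => _ /imsetP [s _ ->]; apply/familyP => i.
  by rewrite ffunE; exact: restr_perm_on.
apply: leq_trans (subset_leq_card sub) _.
rewrite card_family /histfact foldrE big_map big_enum /=; apply: eq_leq.
apply: eq_bigr => i _; rewrite card_perm; congr _`!.
rewrite -sum1_card -sum1_count big_tuple; apply: eq_bigl => j; by rewrite inE.
Qed.

Lemma permt_perm q (s : 'S_q) (I : q.-tuple 'I_n) : perm_eq (permt s I) I.
Proof. by apply/tuple_permP; exists s. Qed.

End Hist.
(** * Spectral norm and traces *)

Section SpectralNorm.
Variables (R : realType) (I : finType).
Implicit Types (A B : I -> I -> R) (x : I -> R).

Lemma cauchy_schwarz x y :
  (\sum_i x i * y i) ^+ 2 <= (\sum_i x i ^+ 2) * (\sum_i y i ^+ 2) :> R.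
Proof.
set a := \sum_i x i ^+ 2; set b := \sum_i y i ^+ 2; set c := \sum_i x i * y i.
have a0 : 0 <= a by apply: sumr_ge0 => i _; exact: sqr_ge0.
have : 0 <= \sum_i (a * y i - c * x i) ^+ 2 by apply: sumr_ge0 => i _; exact: sqr_ge0.
have -> : \sum_i (a * y i - c * x i) ^+ 2 = a * (a * b - c ^+ 2).
  transitivity (\sum_i (a ^+ 2 * y i ^+ 2 - 2 * a * c * (x i * y i) + c ^+ 2 * x i ^+ 2)).
    by apply: eq_bigr => i _; ring.
  rewrite big_split /= sumrB -!mulr_sumr -/a -/b -/c; ring.
have [a_gt0 |] := ltP 0 a; first by rewrite pmulr_rge0 // subr_ge0.
move=> a_le0 _; have a00 : a = 0 by apply/eqP; rewrite eq_le a0 a_le0.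
have x0 i : x i = 0.
  apply/eqP; rewrite -sqrf_eq0; apply/eqP.
  move/eqP: a00; rewrite psumr_eq0 => [|j _]; last exact: sqr_ge0.
  by move/seq.allP/(_ i (mem_index_enum i))/eqP.
rewrite /c big1 => [|i _]; last by rewrite x0 mul0r.
by rewrite expr0n /= mulr_ge0 // sumr_ge0 // => i _; exact: sqr_ge0.
Qed.

(** Kernels on a finite type stand for matrices here, matching the form of [spec_norm]. *)
Definition kmul A B i j : R := \sum_k A i k * B k j.
Definition kpow A m : I -> I -> R := iter m (kmul A) (fun i j => (i == j)%:R).
Definition app A x i : R := \sum_j A i j * x j.
Definition nrm2 x : R := \sum_i x i ^+ 2.

Lemma nrm2_ge0 x : 0 <= nrm2 x.
Proof. by apply: sumr_ge0 => i _; exact: sqr_ge0. Qed.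

Lemma app_kmul A B x i : app (kmul A B) x i = app A (app B x) i.
Proof.
rewrite /app /kmul; under eq_bigr do rewrite mulr_suml; rewrite exchange_big /=.
by apply: eq_bigr => j _; rewrite mulr_sumr; apply: eq_bigr => k _; rewrite mulrA.
Qed.

Lemma kmulA A B C : kmul A (kmul B C) = kmul (kmul A B) C.
Proof.
apply/funext => i; apply/funext => j; rewrite /kmul.
under eq_bigr do rewrite mulr_sumr; rewrite exchange_big /=.
by apply: eq_bigr => k _; rewrite mulr_suml; apply: eq_bigr => l _; rewrite mulrA.
Qed.

Lemma kmul1l A : kmul (fun i j => (i == j)%:R) A = A.
Proof.
apply/funext => i; apply/funext => j; rewrite /kmul (bigD1 i) //= eqxx mul1r.
by rewrite big1 ?addr0 // => k; rewrite eq_sym => /negPf->; rewrite mul0r.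
Qed.

Lemma kpowD A m p : kpow A (m + p) = kmul (kpow A m) (kpow A p).
Proof.
elim: m => [|m IH]; first by rewrite kmul1l.
by rewrite addSn /= IH kmulA.
Qed.

Lemma kpow_sym A m : (forall i j, A i j = A j i) ->
  forall i j, kpow A m i j = kpow A m j i.
Proof.
move=> As; elim: m => [|m IH] i j /=; first by rewrite eq_sym.
have -> : kmul A (kpow A m) j i = kpow A (m + 1) j i by rewrite addnC.
rewrite kpowD /= /kmul; apply: eq_bigr => k _.
rewrite mulrC IH (As i k); congr (_ * _).
rewrite (bigD1 i) //= eqxx mulr1 big1 ?addr0 // => l /negPf->; by rewrite mulr0.
Qed.

(** By symmetry [nrm2 (app A x)] is the inner product of [x] with the image of [x] under the square
    of [A]; Cauchy-Schwarz does the rest. *)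
Lemma nrm2_app_sym A x : (forall i j, A i j = A j i) ->
  nrm2 (app A x) ^+ 2 <= nrm2 x * nrm2 (app (kmul A A) x).
Proof.
move=> As.
have -> : nrm2 (app A x) = \sum_i x i * app (kmul A A) x i.
  under [RHS]eq_bigr do rewrite app_kmul {1}/app mulr_sumr.
  rewrite exchange_big /= /nrm2; apply: eq_bigr => j _.
  rewrite expr2 {1}/app mulr_suml; apply: eq_bigr => i _.
  by rewrite (As j i); ring.
exact: cauchy_schwarz.
Qed.

(** The preceding inequality, applied to [kpow A (2 ^ r)], doubles the exponent. This replaces
    diagonalisation and is the reason for working with powers of two. *)
Lemma nrm2_app_pow A x r : (forall i j, A i j = A j i) -> nrm2 x = 1 ->
  nrm2 (app A x) ^+ (2 ^ r) <= nrm2 (app (kpow A (2 ^ r)) x).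
Proof.
move=> As x1; elim: r => [|r IH].
  have -> // : kpow A (2 ^ 0) = A.
  rewrite expn0 /=; apply/funext => i; apply/funext => j.
  rewrite /kmul (bigD1 j) //= eqxx mulr1 big1 ?addr0 // => l /negPf->; by rewrite mulr0.
have := nrm2_app_sym _ x (kpow_sym _ (2 ^ r) As).
rewrite -kpowD addnn -mul2n -expnS x1 mul1r; apply: le_trans.
by rewrite expnSr exprM lerXn2r // nnegrE ?exprn_ge0 ?nrm2_ge0.
Qed.

Lemma nrm2_app_frob A x : nrm2 (app A x) <= (\sum_i \sum_j A i j ^+ 2) * nrm2 x.
Proof. by rewrite mulr_suml; apply: ler_sum => i _; exact: cauchy_schwarz. Qed.

Lemma frob_kpow A m : (forall i j, A i j = A j i) ->
  \sum_i \sum_j kpow A m i j ^+ 2 = \sum_i kpow A (m + m) i i.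
Proof.
move=> As; apply: eq_bigr => i _; rewrite kpowD /kmul; apply: eq_bigr => j _.
by rewrite expr2 [X in _ * X]kpow_sym.
Qed.

Let S A := [set r : R | exists x : I -> R,
         \sum_(i : I) x i ^+ 2 = 1 /\
         r = Num.sqrt (\sum_(i : I) (\sum_(j : I) A i j * x j) ^+ 2)]%classic.

Lemma spec_norm_ge0 A : 0 <= spec_norm A.
Proof.
(* By default [sup] is [0] on a set without supremum, which happens when [I] is empty and there is
   no unit vector. *)
have [hS|/sup_out Sout] := pselect (has_sup (S A)); last by rewrite /spec_norm Sout.
have [[y [x [x1 yE]]] bS] := hS; apply: (@le_trans _ _ y).
  by rewrite yE sqrtr_ge0.
by apply: ub_le_sup bS _ _; exists x.
Qed.

Lemma spec_norm_le A M : 0 <= M ->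
  (forall x, nrm2 x = 1 -> Num.sqrt (nrm2 (app A x)) <= M) -> spec_norm A <= M.
Proof.
move=> M0 H; have [|/set0P S0] := eqVneq (S A) set0.
  by rewrite /spec_norm -/(S A) => ->; rewrite sup0.
by apply: ge_sup => // _ [x [x1 ->]]; exact: H.
Qed.

Lemma nrm2_app_le A x : nrm2 (app A x) <= spec_norm A ^+ 2 * nrm2 x.
Proof.
have [x0|x0] := eqVneq (nrm2 x) 0.
  have := nrm2_app_frob A x; by rewrite x0 !mulr0.
have x_gt0 : 0 < nrm2 x by rewrite lt_neqAle eq_sym x0 nrm2_ge0.
pose c := (Num.sqrt (nrm2 x))^-1.
have c2 : c ^+ 2 = (nrm2 x)^-1 by rewrite exprVn sqr_sqrtr ?nrm2_ge0.
pose y i := c * x i.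
have y1 : nrm2 y = 1.
  by rewrite /nrm2; under eq_bigr do rewrite exprMn; rewrite -mulr_sumr c2 mulVf.
have Ay : nrm2 (app A y) = (nrm2 x)^-1 * nrm2 (app A x).
  rewrite -c2 /nrm2 mulr_sumr; apply: eq_bigr => i _; rewrite -exprMn; congr (_ ^+ 2).
  by rewrite /app mulr_sumr; apply: eq_bigr => j _; rewrite /y; ring.
rewrite -ler_pdivrMr // mulrC -Ay -(sqr_sqrtr (nrm2_ge0 (app A y))).
rewrite lerXn2r ?nnegrE ?spec_norm_ge0 ?sqrtr_ge0 //.
apply: ub_le_sup; last by exists y.
(* The Frobenius norm bounds the set, so its [sup] is a genuine upper bound. *)
exists (Num.sqrt (\sum_i \sum_j A i j ^+ 2)) => _ [z [z1 ->]].
by rewrite ler_wsqrtr // -[X in _ <= X]mulr1 -z1; exact: nrm2_app_frob.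
Qed.

Lemma quadratic_form_le A x :
  `|\sum_i x i * app A x i| <= spec_norm A * nrm2 x.
Proof.
rewrite -(@ler_pXn2r _ 2) ?nnegrE ?normr_ge0 ?mulr_ge0 ?spec_norm_ge0 ?nrm2_ge0 //.
rewrite real_normK ?num_real // exprMn; apply: le_trans (cauchy_schwarz _ _) _.
rewrite mulrC expr2 mulrA; apply: ler_wpM2r; [exact: nrm2_ge0 | exact: nrm2_app_le].
Qed.

(** On a unit vector, raising the norm of the image to the power [2 ^ r.+1] gives at most the
    squared norm of its image under [kpow A (2 ^ r)], hence at most the squared Frobenius norm of
    that power, which is the trace on the right. *)
Lemma spec_norm_trace A r : (forall i j, A i j = A j i) ->
  spec_norm A ^+ (2 ^ r.+1) <= \sum_i kpow A (2 ^ r.+1) i i.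
Proof.
move=> As; set t := \sum_i _.
have E : t = \sum_i \sum_j kpow A (2 ^ r) i j ^+ 2.
  by rewrite frob_kpow // addnn -mul2n -expnS.
have t0 : 0 <= t.
  by rewrite E; apply: sumr_ge0 => i _; apply: sumr_ge0 => j _; exact: sqr_ge0.
have N0 : (2 ^ r.+1 != 0)%N by rewrite expn_eq0.
have N1 : (2 ^ r.+1)%:R != 0 :> R by rewrite pnatr_eq0.
have tN : (t `^ ((2 ^ r.+1)%:R^-1)) ^+ (2 ^ r.+1) = t.
  by rewrite -powR_mulrn ?powR_ge0 // -powRrM mulVf // powRr1.
rewrite -[X in _ <= X]tN lerXn2r ?nnegrE ?spec_norm_ge0 ?powR_ge0 //.
apply: spec_norm_le => [|x x1]; first exact: powR_ge0.
rewrite -(@ler_pXn2r _ (2 ^ r.+1)) ?nnegrE ?sqrtr_ge0 ?powR_ge0 ?lt0n // tN.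
rewrite expnS exprM sqr_sqrtr ?nrm2_ge0 //.
apply: le_trans (nrm2_app_pow _ _ r As x1) _.
by rewrite E -[X in _ <= X]mulr1 -x1; exact: nrm2_app_frob.
Qed.

End SpectralNorm.
(** * The refutation bound *)

Section Blocks.
Variables (R : realType) (n : nat).
Implicit Types (g : seq 'I_n -> seq 'I_n -> R) (u v I J : seq 'I_n).

(** With [g := SPhi T] and [h := k./2] this is [SPhid T], freed from the type of tuples so that the
    first block can be peeled off by induction on [d]. *)
Definition blkprod g h d I J : R := \prod_(s < d) g (blk h s I) (blk h s J).

Lemma blkprodS g h d u v I J : size u = h -> size v = h ->
  blkprod g h d.+1 (u ++ I) (v ++ J) = g u v * blkprod g h d I J.
Proof.
have b0 w K : size w = h -> blk h 0 (w ++ K) = w.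
  by move=> wh; rewrite /blk mul0n drop0 -wh take_size_cat.
have bS s w K : size w = h -> blk h s.+1 (w ++ K) = blk h s K.
  by move=> wh; rewrite /blk drop_cat wh ltnNge mulSn leq_addr /= addKn.
move=> uh vh; rewrite /blkprod big_ord_recl /= !b0 //; congr (_ * _).
by apply: eq_bigr => s _; rewrite !bS.
Qed.

Lemma sum_blkprod g h d (x : 'I_n -> R) :
  sumt R n (h * d) (fun I => sumt R n (h * d) (fun J =>
    blkprod g h d I J * (\prod_(i <- I) x i * \prod_(j <- J) x j))) =
  (sumt R n h (fun u => sumt R n h (fun v =>
    g u v * (\prod_(i <- u) x i * \prod_(j <- v) x j)))) ^+ d.
Proof.
elim: d => [|d IH]; first by rewrite muln0 !sumt0 /blkprod !big_nil big_ord0 !mulr1.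
rewrite mulnS sumtD.
under [LHS]eq_sumt => u uh.
  under eq_sumt => I _.
    rewrite sumtD.
    under eq_sumt => v vh.
      under eq_sumt => J _.
        rewrite blkprodS // !big_cat /=.
        have -> : forall a b c d e f : R, a * b * (c * d * (e * f)) = (a * (c * e)) * (b * (d * f)).
          by move=> *; ring.
        over.
      rewrite sumtZ.
      over.
    rewrite sumtZr.
    over.
  rewrite sumtZ.
  over.
by rewrite sumtZr IH exprS.
Qed.

End Blocks.

Section Refutes.
Variables (R : realType) (n k d : nat) (T : {ffun k.-tuple 'I_n -> R}).
Hypothesis even_k : ~~ odd k.
Let h := k./2.
Let q := (k./2 * d)%N.

Lemma addhh : (h + h = k)%N.
Proof. by rewrite addnn even_halfK. Qed.

Lemma SPhi_sym u v : SPhi T u v = SPhi T v u.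
Proof. by rewrite /SPhi addrC. Qed.

Lemma RPhid_norm_sym (I J : q.-tuple 'I_n) : RPhid_norm T I J = RPhid_norm T J I.
Proof.
rewrite /RPhid_norm; have -> : RPhid T I J = RPhid T J I; last by ring.
rewrite /RPhid exchange_big /=; congr (_ * _).
apply: eq_bigr => s _; apply: eq_bigr => t _; apply: eq_bigr => j _.
exact: SPhi_sym.
Qed.

Lemma lookup_tuple (S : k.-tuple 'I_n) : lookup T S = T S.
Proof. by rewrite /lookup; have -> : insub (tval S) = Some S := valK S. Qed.

(** Symmetrizing the matrix leaves its quadratic form unchanged: exchanging [u] and [v] shows that
    both orders of concatenation contribute equally. *)
Lemma sum_SPhi (x : 'I_n -> R) :
  sumt R n h (fun u => sumt R n h (fun v =>
    SPhi T u v * (\prod_(i <- u) x i * \prod_(j <- v) x j))) =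
  \sum_(S : k.-tuple 'I_n) T S * \prod_(i < k) x (tnth S i).
Proof.
pose F s := lookup T s * \prod_(i <- s) x i.
have -> : \sum_(S : k.-tuple 'I_n) T S * \prod_(i < k) x (tnth S i) =
          sumt R n k F.
  by apply: eq_bigr => S _; rewrite /F lookup_tuple big_tuple.
have -> : sumt R n k F = sumt R n (h + h) F by rewrite addhh.
rewrite sumtD.
set X := RHS; have X2 : X = sumt R n h (fun u => sumt R n h (fun v => F (v ++ u))).
  by rewrite sumt_exchange.
have -> : X = (X + sumt R n h (fun u => sumt R n h (fun v => F (v ++ u)))) / 2.
  by rewrite -X2; field.
rewrite /X /sumt -big_split /= mulr_suml; apply: eq_bigr => u _.
rewrite -big_split /= mulr_suml; apply: eq_bigr => v _.
by rewrite /F /SPhi !big_cat /=; field.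
Qed.

Lemma permt_bij (s : 'S_q) : bijective (@permt n q s).
Proof.
exists (permt (s^-1)%g) => I; apply: eq_from_tnth => j; rewrite !tnth_mktuple.
  by rewrite permKV.
by rewrite permK.
Qed.

(** The square roots in [v] cancel the normalization. The monomial of [I] is invariant under
    permutations of [I], so all pairs of permutations contribute the same sum and their number
    cancels the prefactor. What remains factors over the [d] blocks. *)
Lemma RPhid_norm_quadratic (x : 'I_n -> R) :
  let v := fun I : q.-tuple 'I_n => Num.sqrt (histfact I)%:R * \prod_(i <- I) x i in
  \sum_I v I * app R _ (@RPhid_norm R n k d T) v I =
  (\sum_(S : k.-tuple 'I_n) T S * \prod_(i < k) x (tnth S i)) ^+ d.
Proof.
move=> v; have sq0 (I : seq 'I_n) : Num.sqrt (histfact I)%:R != 0 :> R.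
  by rewrite gt_eqF // sqrtr_gt0 ltr0n histfact_gt0.
have f0 : (q`!)%:R != 0 :> R by rewrite pnatr_eq0 -lt0n fact_gt0.
pose G (I J : q.-tuple 'I_n) := SPhid T I J * (\prod_(i <- I) x i * \prod_(j <- J) x j).
have GP (s t : 'S_q) : \sum_I \sum_J G (permt s I) (permt t J) = \sum_I \sum_J G I J.
  rewrite [RHS](reindex _ (onW_bij _ (permt_bij s))) /=; apply: eq_bigr => I _.
  by rewrite [RHS](reindex _ (onW_bij _ (permt_bij t))).
rewrite -sum_SPhi -sum_blkprod.
transitivity (\sum_I \sum_J G I J); last by [].
transitivity (((q`!)%:R ^+ 2)^-1 * \sum_(s : 'S_q) \sum_(t : 'S_q) \sum_I \sum_J G (permt s I) (permt t J)).
  transitivity (\sum_I \sum_J ((q`!)%:R ^+ 2)^-1 * \sum_(s : 'S_q) \sum_(t : 'S_q) G (permt s I) (permt t J)).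
    apply: eq_bigr => I _; rewrite /app mulr_sumr; apply: eq_bigr => J _.
    rewrite /v /RPhid_norm /RPhid.
    rewrite [LHS](_ : _ = ((q`!)%:R ^+ 2)^-1 * ((\sum_(s : 'S_q) \sum_(t : 'S_q)
       SPhid T (permt s I) (permt t J)) * (\prod_(i <- I) x i * \prod_(j <- J) x j))).
      congr (_ * _); rewrite mulr_suml; apply: eq_bigr => s _.
      rewrite mulr_suml; apply: eq_bigr => t _.
      by rewrite /G (perm_big _ (permt_perm _ _ s I)) (perm_big _ (permt_perm _ _ t J)).
    have := sq0 I; have := sq0 J; rewrite -/q; set a := Num.sqrt _; set b := Num.sqrt _.
    move=> a0 b0; set c := _%:R; set X := \sum_s _; set Y := \prod_(i <- I) _; set Z := \prod_(j <- J) _.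
    by move: f0; rewrite -/c => c0; field; rewrite c0 a0 b0.
  under eq_bigr do rewrite -mulr_sumr; rewrite -mulr_sumr; congr (_ * _).
  under eq_bigr do rewrite exchange_big /=; rewrite exchange_big /=; apply: eq_bigr => s _.
  under eq_bigr do rewrite exchange_big /=; rewrite exchange_big /=; apply: eq_bigr => t _.
  by [].
under eq_bigr => s _ do under eq_bigr => t _ do rewrite GP.
rewrite !sumr_const (_ : #|_| = q`!); last by rewrite -card_Sn; apply: eq_card.
rewrite -mulrnA -[X in _ * X]mulr_natl natrM mulrA -expr2.
by rewrite mulVf ?mul1r // expf_neq0.
Qed.

(** Each constraint contributes [1] if satisfied and [-1] otherwise. *)
Lemma sum_constraints (x : 'I_n -> R) : is_instance T ->
  (forall i, x i = 1 \/ x i = -1) -> (0 < nconstr T)%N ->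
  \sum_(S : k.-tuple 'I_n) T S * \prod_(i < k) x (tnth S i) =
  2 * (nconstr T)%:R * (sat T x - 1 / 2).
Proof.
move=> iT x1 m0; have m0' : (nconstr T)%:R != 0 :> R by rewrite pnatr_eq0 -lt0n.
have -> : 2 * (nconstr T)%:R * (sat T x - 1 / 2) =
    2 * (sat T x * (nconstr T)%:R) - (nconstr T)%:R by field.
rewrite /sat divfK // /nconstr -!sum1_card !natr_sum mulr_sumr.
rewrite (big_mkcond (fun S => S \in [set S | T S != 0])) /=.
rewrite (big_mkcond (fun S => S \in [set S | (T S != 0) && _])) /= -sumrB.
apply: eq_bigr => S _; rewrite !inE.
have xS : \prod_(i < k) x (tnth S i) = 1 \/ \prod_(i < k) x (tnth S i) = -1.
  elim/big_ind: _ => [|a b [->|->] [->|->]|i _]; rewrite ?mulr1 ?mulrN1 ?opprK; by [left|right|].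
have N11 : (-1 == 1 :> R) = false by rewrite lt_eqF //; lra.
have N10 : (-1 == 0 :> R) = false by rewrite lt_eqF //; lra.
case: (iT S) => [->|[->|->]]; rewrite ?eqxx ?N10 ?oner_eq0 /=; [by rewrite mul0r subr0| |];
  case: xS => ->; rewrite ?eqxx ?N11 ?(eq_sym 1) ?N11 /=; ring.
Qed.

Lemma sat_dist_le_sathat (x : 'I_n -> R) : (0 < d)%N -> (d <= n)%N -> is_instance T ->
  (0 < nconstr T)%N -> (forall i, x i = 1 \/ x i = -1) ->
  `|sat T x - 1 / 2| <= sathat d T - 1 / 2.
Proof.
move=> d0 dn iT m0 x1; have n0 : (0 < n)%N by apply: leq_trans dn.
have M0 : 0 < (nconstr T)%:R :> R by rewrite ltr0n.
set s := sat T x - 1 / 2; set m := (nconstr T)%:R in M0 *.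
rewrite /sathat addrAC subrr add0r -/m.
set nu := spec_norm _; set rho := _ / _.
have nu0 : 0 <= nu by exact: spec_norm_ge0.
have rho0 : 0 <= rho by rewrite divr_ge0.
have key : `|2 * m * s| ^+ d <= nu * rho.
  rewrite /s /m -sum_constraints // -normrX -RPhid_norm_quadratic.
  apply: le_trans (quadratic_form_le _ _ _ _) _; apply: ler_wpM2l => //.
  rewrite /rho -sum_histfact // /nrm2; apply: ler_sum => I _.
  rewrite exprMn sqr_sqrtr // -prodrXl big1 ?mulr1 // => i _.
  by case: (x1 i) => ->; rewrite ?expr1n ?sqrrN ?expr1n.
have dR : d%:R != 0 :> R by rewrite pnatr_eq0 -lt0n.
have : `|2 * m * s| <= (nu * rho) `^ (d%:R^-1).
  rewrite -(@ler_pXn2r _ d) ?nnegrE ?normr_ge0 ?powR_ge0 //.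
  by rewrite -[X in _ <= X]powR_mulrn ?powR_ge0 // -powRrM mulVf // powRr1 // mulr_ge0.
rewrite powRM // normrM (gtr0_norm (_ : 0 < 2 * m)) ?mulr_gt0 // mulrC -ler_pdivlMr ?mulr_gt0 //.
by rewrite mulrC mulrA.
Qed.

End Refutes.
(** * Means of monomials in the constraints *)

Section Expectation.
Variables (R : realType) (n k : nat) (p : R).
Hypothesis p01 : 0 <= p <= 1.
Local Notation tensor := {ffun k.-tuple 'I_n -> R}.
Local Notation outcome := {ffun k.-tuple 'I_n -> option bool}.

Definition Ex (X : tensor -> R) : R := \sum_(w : outcome) weight p w * X (@tensor_of R n k w).

Let p0 : 0 <= p. Proof. by case/andP: p01. Qed.
Let p1 : p <= 1. Proof. by case/andP: p01. Qed.

Lemma weight_ge0 (w : outcome) : 0 <= weight p w.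
Proof.
apply: prodr_ge0 => S _; case: (w S) => [_|]; first by rewrite divr_ge0.
by rewrite subr_ge0.
Qed.

Lemma Ex_le X Y : (forall w : outcome, X (tensor_of R w) <= Y (tensor_of R w)) -> Ex X <= Ex Y.
Proof. by move=> XY; apply: ler_sum => w _; apply: ler_wpM2l; rewrite ?weight_ge0. Qed.

Lemma eq_Ex X Y : (forall T, X T = Y T) -> Ex X = Ex Y.
Proof. by move=> XY; apply: eq_bigr => w _; rewrite XY. Qed.

Lemma ExD X Y : Ex (fun T => X T + Y T) = Ex X + Ex Y.
Proof. by rewrite /Ex -big_split; apply: eq_bigr => w _; rewrite mulrDr. Qed.

Lemma ExZ c X : Ex (fun T => c * X T) = c * Ex X.
Proof. by rewrite /Ex mulr_sumr; apply: eq_bigr => w _; rewrite mulrCA. Qed.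

Lemma Ex_sum (I : finType) (P : pred I) (X : I -> tensor -> R) :
  Ex (fun T => \sum_(i | P i) X i T) = \sum_(i | P i) Ex (X i).
Proof.
by rewrite /Ex exchange_big; apply: eq_bigr => w _; rewrite mulr_sumr.
Qed.

(** Independence of the entries: a product of functions of single entries has the product of the
    means as its mean. *)
Lemma Ex_prod (g : k.-tuple 'I_n -> option bool -> R) :
  \sum_(w : outcome) weight p w * \prod_S g S (w S) =
  \prod_S ((1 - p) * g S None + p / 2 * (g S (Some true) + g S (Some false))).
Proof.
pose f S (o : option bool) := (if o is Some _ then p / 2 else 1 - p) * g S o.
transitivity (\prod_S \sum_(o : option bool) f S o).
  rewrite bigA_distr_bigA; apply: eq_bigr => w _; rewrite /weight -big_split /=.
  by apply: eq_bigr => S _; rewrite /f; case: (w S).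
apply: eq_bigr => S _; rewrite (bigD1 None) //= (bigD1 (Some true)) //=.
rewrite (bigD1 (Some false)) //= big1 => [|[[]|]] //; rewrite /f; ring.
Qed.

Lemma Ex_cst c : Ex (fun=> c) = c.
Proof.
rewrite /Ex -mulr_suml [X in X * _](_ : _ = 1) ?mul1r //.
transitivity (\sum_(w : outcome) weight p w * \prod_(S : k.-tuple 'I_n) 1).
  by apply: eq_bigr => w _; rewrite [X in _ * X]big1 ?mulr1.
by rewrite (Ex_prod (fun _ _ => 1)) big1 // => S _; field.
Qed.

Lemma prod_count (T : tensor) (m : seq (k.-tuple 'I_n)) :
  \prod_(c <- m) T c = \prod_S T S ^+ count_mem S m.
Proof.
elim: m => [|c m IH]; first by rewrite big_nil big1.
rewrite big_cons IH /= -[T c](_ : \prod_S T S ^+ (c == S) = _).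
  by rewrite -big_split; apply: eq_bigr => S _; rewrite /= exprD.
by rewrite (bigD1 c) //= eqxx big1 ?mulr1 // => S; rewrite eq_sym => /negPf->.
Qed.

Lemma undup_even_le (m : seq (k.-tuple 'I_n)) :
  (forall S, ~~ odd (count_mem S m)) -> (2 * size (undup m) <= size m)%N.
Proof.
move=> ev; have -> : size m = (\sum_S count_mem S m)%N.
  elim: m {ev} => [|x s IH] /=; first by rewrite big1.
  rewrite big_split /= -IH (bigD1 x) //= eqxx big1 ?addn0 // => i.
  by rewrite eq_sym => /negPf->.
rewrite -(card_uniqP (undup_uniq m)) mulnC -sum_nat_const big_mkcond /=.
apply: leq_sum => S _; rewrite mem_undup; case: ifP => // Sm.
have : (0 < count_mem S m)%N by rewrite -has_count has_pred1.
by have := ev S; case: (count_mem S m) => [|[]].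
Qed.

Variables (L : nat) (lam : R).
Hypotheses (lam0 : 0 < lam) (lam1 : lam <= 1).

(** A majorant for the mean of the monomial [m] of degree at most [2 * L], designed to evolve
    simply: adding a new constraint multiplies it by [lam * p], repeating an old one leaves it
    unchanged. *)
Definition phi (T : eqType) (m : seq T) : R := lam ^- L * (lam * p) ^+ size (undup m).

Lemma phi_ge0 (T : eqType) (m : seq T) : 0 <= phi T m.
Proof. by rewrite mulr_ge0 ?invr_ge0 ?exprn_ge0 ?mulr_ge0 // ltW. Qed.

(* Only monomials with all exponents even have nonzero mean; they involve at most
   half as many constraints as their degree, so [lam <= 1] can be traded in. *)
Lemma Ex_monomial (m : seq (k.-tuple 'I_n)) : (size m <= 2 * L)%N ->
  0 <= Ex (fun T => \prod_(c <- m) T c) <= phi _ m.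
Proof.
(* [e c] is the mean of the [c]-th power of one entry; since [0 ^+ 0] is [1], [e 0] is [1] as it
   should be. *)
move=> mL; pose e c : R := (1 - p) * 0 ^+ c + p / 2 * (1 ^+ c + (-1) ^+ c).
have -> : Ex (fun T => \prod_(c <- m) T c) = \prod_S e (count_mem S m).
  have := Ex_prod (fun S o =>
    (if o is Some b then (if b then 1 else -1) else 0) ^+ count_mem S m).
  move=> <-; apply: eq_bigr => w _; rewrite prod_count; congr (_ * _).
  by apply: eq_bigr => S _; rewrite ffunE.
have [/existsP [S Sodd]|/existsPn ev] := boolP [exists S, odd (count_mem S m)].
  rewrite (bigD1 S) //= (_ : e _ = 0) ?mul0r ?lexx ?phi_ge0 //.
  rewrite /e -signr_odd Sodd expr1n expr0n; move: Sodd.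
  by case: (count_mem S m) => // c _; rewrite /= expr1; ring.
have -> : \prod_S e (count_mem S m) = p ^+ size (undup m).
  rewrite -(card_uniqP (undup_uniq m)) -prodr_const [RHS]big_mkcond /=.
  apply: eq_bigr => S _; rewrite mem_undup /e -signr_odd (negPf (ev S)) expr1n expr0 expr0n.
  rewrite -has_pred1 has_count; by case: (count_mem S m) => [|c] /=; field.
rewrite exprn_ge0 //= /phi exprMn mulrA ler_peMl ?exprn_ge0 //.
rewrite mulrC ler_pdivlMr ?exprn_gt0 // mul1r ler_wiXn2l // ?ltW //.
by have := undup_even_le m ev; lia.
Qed.

(** A sequence of length other than [k] makes the monomial vanish, because [lookup] is [0] there;
    otherwise everything transfers along the injection of tuples into sequences. *)
Lemma Ex_monomial_seq (m : seq (seq 'I_n)) : (size m <= 2 * L)%N ->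
  0 <= Ex (fun T => \prod_(c <- m) lookup T c) <= phi _ m.
Proof.
have [/seq.allP mk|/seq.allPn [c cm ck]] := boolP (all (fun c => size c == k) m); last first.
  move=> _; suff -> : Ex (fun T => \prod_(c <- m) lookup T c) = 0 by rewrite lexx phi_ge0.
  rewrite /Ex big1 // => w _; rewrite (big_rem c) //= {1}/lookup insubF ?mul0r ?mulr0 //.
  exact: negPf ck.
have [m' ->] : exists m' : seq (k.-tuple 'I_n), m = map val m'.
  elim: m mk => [|c m IH] mk; first by exists [::].
  have [m' ->] := IH (fun x xm => mk x (mem_behead (s := c :: m) xm)).
  by exists (Tuple (mk c (mem_head _ _)) :: m').
rewrite size_map /phi undup_map_inj ?size_map; last exact: val_inj.
move=> mL.
rewrite (@eq_Ex _ (fun T => \prod_(c <- m') T c)); first exact: Ex_monomial.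
by move=> T; rewrite big_map; apply: eq_bigr => c _; rewrite lookup_tuple.
Qed.

(* The quantification over the past [m0] makes the bound stable under revealing one more
   constraint; [N] bounds the degree of [X]. *)
Definition dominated (X : tensor -> R) (N : nat) (B : R) : Prop :=
  forall m0 : seq (seq 'I_n), (size m0 + N <= 2 * L)%N ->
  0 <= Ex (fun T => X T * \prod_(c <- m0) lookup T c) <= B * phi _ m0.

Lemma eq_dominated X Y N B : (forall T, X T = Y T) -> dominated X N B -> dominated Y N B.
Proof.
move=> XY gX m0 /gX.
by rewrite (@eq_Ex _ (fun T => Y T * \prod_(c <- m0) lookup T c)) // => T; rewrite XY.
Qed.

Lemma dominated_cst c B : 0 <= c <= B -> dominated (fun=> c) 0 B.
Proof.
move=> /andP [c0 cB] m0; rewrite addn0 => /Ex_monomial_seq /andP [E0 E1].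
rewrite ExZ mulr_ge0 //=; apply: ler_pM => //.
Qed.

Lemma dominated_le X N B B' : B <= B' -> dominated X N B -> dominated X N B'.
Proof.
move=> BB gX m0 /gX /andP [-> H] /=; apply: le_trans H _.
by rewrite ler_wpM2r ?phi_ge0.
Qed.

Lemma dominatedZ c X N B : 0 <= c -> dominated X N B -> dominated (fun T => c * X T) N (c * B).
Proof.
move=> c0 gX m0 /gX /andP [H0 H1].
have -> : Ex (fun T => c * X T * \prod_(c <- m0) lookup T c) =
          c * Ex (fun T => X T * \prod_(c <- m0) lookup T c).
  by rewrite -ExZ; apply: eq_Ex => T; rewrite -mulrA.
by rewrite mulr_ge0 //= -mulrA ler_wpM2l.
Qed.

Lemma dominated_sum (I : finType) (X : I -> tensor -> R) N (B : I -> R) :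
  (forall i, dominated (X i) N (B i)) -> dominated (fun T => \sum_i X i T) N (\sum_i B i).
Proof.
move=> gX m0 mN.
have -> : Ex (fun T => (\sum_i X i T) * \prod_(c <- m0) lookup T c) =
          \sum_i Ex (fun T => X i T * \prod_(c <- m0) lookup T c).
  by rewrite -Ex_sum; apply: eq_Ex => T; rewrite mulr_suml.
rewrite mulr_suml sumr_ge0 /= => [|i _]; last by case/andP: (gX i m0 mN).
by apply: ler_sum => i _; case/andP: (gX i m0 mN).
Qed.

(** The constraint [c] moves from the random variable into the past, at the price of one unit of
    degree. *)
Lemma dominated_mul_lookup c X N B : dominated X N B -> forall m0 : seq (seq 'I_n),
  (size m0 + N.+1 <= 2 * L)%N ->
  0 <= Ex (fun T => lookup T c * X T * \prod_(c <- m0) lookup T c) <= B * phi _ (c :: m0).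
Proof.
move=> gX m0; rewrite addnS -addSn => /(gX (c :: m0)).
rewrite (@eq_Ex _ (fun T => lookup T c * X T * \prod_(c <- m0) lookup T c)) // => T.
by rewrite big_cons; ring.
Qed.

(** The multiplicity of [c] stands in for the indicator that [c] was already revealed, because its
    sum over all [c] is at most the size of [m0]. *)
Lemma phi_cons (c : seq 'I_n) m0 :
  phi _ (c :: m0) <= (lam * p + (count_mem c m0)%:R) * phi _ m0.
Proof.
rewrite /phi /=; case: ifPn => cm.
  rewrite ler_peMl //; first exact: phi_ge0.
  rewrite -[X in X <= _]add0r; apply: lerD; first by rewrite mulr_ge0 // ltW.
  by rewrite ler1n -has_count has_pred1.
by rewrite (count_memPn cm) addr0 /= exprS mulrCA.
Qed.

Lemma sumt_ler N (F G : seq 'I_n -> R) :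
  (forall s, size s = N -> F s <= G s) -> sumt R n N F <= sumt R n N G.
Proof. by move=> FG; apply: ler_sum => I _; rewrite FG ?size_tuple. Qed.

Lemma sumt_count_le N (m : seq (seq 'I_n)) :
  sumt R n N (fun s => (count_mem s m)%:R) <= (size m)%:R.
Proof.
rewrite /sumt; elim: m => [|c m IH]; first by rewrite big1.
under eq_bigr do rewrite /= natrD.
rewrite big_split /= -add1n natrD; apply: lerD => //.
have [/eqP cN|cN] := boolP (size c == N).
  rewrite (bigD1 (Tuple (introT eqP cN))) //= eqxx big1 ?addr0 // => S.
  by rewrite -val_eqE /= eq_sym => /negPf ->.
rewrite big1 // => S _; case: eqP => // cS; by rewrite cS size_tuple eqxx in cN.
Qed.

Lemma sumt_all_mem_le h (J : seq 'I_n) :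
  sumt R n h (fun u => (all (mem J) u)%:R) <= (size J)%:R ^+ h.
Proof.
elim: h => [|h IH]; first by rewrite sumt0.
rewrite sumtS /= exprS.
under eq_bigr do under eq_sumt do rewrite -mulnb natrM.
under eq_bigr do rewrite sumtZ.
rewrite -mulr_suml; apply: ler_pM => //.
- exact: sumr_ge0.
- exact: sumr_ge0.
rewrite -natr_sum ler_nat -sum_count_mem; apply: leq_sum => i _.
by case: (boolP (i \in J)) => // iJ; rewrite -has_count has_pred1.
Qed.

Lemma sumt_cst h (c : R) : sumt R n h (fun=> c) = n%:R ^+ h * c.
Proof. by rewrite /sumt sumr_const card_tuple card_ord -[LHS]mulr_natl natrX. Qed.

(** Fresh constraints: [u] uses letters of [J] and [v] is free, which bounds the number of pairs.
    Repeated ones: all pairs together hit [m0] at most [size m0] times. The flag [sw] covers the two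
    orders of concatenation in [SPhi]. *)
Lemma phi_cat_sum h (J : seq 'I_n) (m0 : seq (seq 'I_n)) (sw : bool) :
  sumt R n h (fun u => sumt R n h (fun v =>
     (all (mem J) u)%:R * phi _ ((if sw then v ++ u else u ++ v) :: m0))) <=
  (lam * p * ((size J)%:R ^+ h * n%:R ^+ h) + (size m0)%:R) * phi _ m0.
Proof.
pose c (u v : seq 'I_n) := if sw then v ++ u else u ++ v.
apply: (@le_trans _ _ (sumt R n h (fun u => sumt R n h (fun v =>
   ((all (mem J) u)%:R * (lam * p) + (count_mem (c u v) m0)%:R) * phi _ m0)))).
  apply: sumt_ler => u _; apply: sumt_ler => v _.
  case: (all _ u); rewrite ?mul0r ?mul1r; first exact: phi_cons.
  by rewrite add0r mulr_ge0 ?phi_ge0.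
under eq_sumt do rewrite sumtZr; rewrite sumtZr ler_wpM2r ?phi_ge0 //.
have -> : sumt R n h (fun u => sumt R n h (fun v =>
   (all (mem J) u)%:R * (lam * p) + (count_mem (c u v) m0)%:R)) =
   lam * p * (sumt R n h (fun u => (all (mem J) u)%:R) * n%:R ^+ h) +
   sumt R n (h + h) (fun s => (count_mem s m0)%:R).
  rewrite sumtD.
  have -> : sumt R n h (fun u => sumt R n h (fun v => (count_mem (u ++ v) m0)%:R)) =
    sumt R n h (fun u => sumt R n h (fun v => (count_mem (c u v) m0)%:R : R)).
    by rewrite /c; case: (sw) => //; rewrite sumt_exchange.
  rewrite -sumtZr -sumtZ /sumt -big_split /=; apply: eq_bigr => u _.
  rewrite big_split /=; congr (_ + _); rewrite sumr_const card_tuple card_ord.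
  by rewrite -[LHS]mulr_natl natrX; ring.
apply: lerD; last exact: sumt_count_le.
apply: ler_wpM2l; first by rewrite mulr_ge0 // ltW.
by rewrite ler_wpM2r ?exprn_ge0 // sumt_all_mem_le.
Qed.

Lemma dominated_block h q (J : seq 'I_n) (Y : seq 'I_n -> seq 'I_n -> tensor -> R) N B :
  size J = q -> 0 <= B ->
  (forall u v, size u = h -> size v = h -> dominated (Y u v) N (B * (all (mem J) u)%:R)) ->
  dominated (fun T => sumt R n h (fun u => sumt R n h (fun v => SPhi T u v * Y u v T))) N.+1
    (B * (lam * p * (q%:R ^+ h * n%:R ^+ h) + (2 * L)%:R)).
Proof.
move=> Jq B0 gY m0 mN; set W := _ + _%:R.
pose F sw u v T := lookup T (if sw then v ++ u else u ++ v) * Y u v T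
                   * \prod_(c <- m0) lookup T c.
pose E sw u v := Ex (F sw u v).
have -> : Ex (fun T => sumt R n h (fun u => sumt R n h (fun v => SPhi T u v * Y u v T))
                 * \prod_(c <- m0) lookup T c) =
   2^-1 * (sumt R n h (fun u => sumt R n h (fun v => E false u v)) +
           sumt R n h (fun u => sumt R n h (fun v => E true u v))).
  rewrite (@eq_Ex _ (fun T => 2^-1 * \sum_(u : h.-tuple 'I_n) \sum_(v : h.-tuple 'I_n)
     (F false u v T + F true u v T))); last first.
    move=> T; rewrite /sumt mulr_suml mulr_sumr; apply: eq_bigr => u _.
    rewrite mulr_suml mulr_sumr; apply: eq_bigr => v _; rewrite /F /SPhi; by field.
  rewrite ExZ Ex_sum; congr (_ * _); rewrite /sumt -big_split; apply: eq_bigr => u _.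
  rewrite Ex_sum -big_split; apply: eq_bigr => v _; exact: ExD.
have bd sw : 0 <= sumt R n h (fun u => sumt R n h (fun v => E sw u v)) <= B * W * phi _ m0.
  have H u v : size u = h -> size v = h -> 0 <= E sw u v <=
      B * ((all (mem J) u)%:R * phi _ ((if sw then v ++ u else u ++ v) :: m0)).
    by move=> uh vh; rewrite mulrA; apply: dominated_mul_lookup (gY u v uh vh) _ _.
  apply/andP; split.
    apply: sumr_ge0 => u _; apply: sumr_ge0 => v _.
    by case/andP: (H u v (size_tuple _) (size_tuple _)).
  apply: le_trans (_ : B * sumt R n h (fun u => sumt R n h (fun v =>
     (all (mem J) u)%:R * phi _ ((if sw then v ++ u else u ++ v) :: m0))) <= _).
    rewrite -sumtZ; apply: sumt_ler => u uh; rewrite -sumtZ; apply: sumt_ler => v vh.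
    by case/andP: (H u v uh vh).
  rewrite -mulrA ler_wpM2l //; apply: le_trans (phi_cat_sum _ _ _ _) _.
  (* The degree budget keeps the past [m0] no longer than [2 * L]. *)
  rewrite ler_wpM2r ?phi_ge0 // Jq lerD2l ler_nat; lia.
case/andP: (bd false) => a0 a1; case/andP: (bd true) => b0 b1.
by apply/andP; split; lra.
Qed.

(** The indicator that all letters lie in [J] is multiplicative under concatenation. The part
    belonging to the first block is absorbed into [B] when the induction hypothesis is applied to
    the other blocks. *)
Lemma dominated_blocks h q (J : seq 'I_n) d (Y : seq 'I_n -> seq 'I_n -> tensor -> R) N B :
  size J = q -> 0 <= B ->
  (forall u v, size u = (h * d)%N -> size v = (h * d)%N ->
     dominated (Y u v) N (B * (all (mem J) u)%:R)) ->
  dominated (fun T => sumt R n (h * d) (fun u => sumt R n (h * d) (fun v =>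
                   blkprod R n (SPhi T) h d u v * Y u v T))) (N + d)
    (B * (lam * p * (q%:R ^+ h * n%:R ^+ h) + (2 * L)%:R) ^+ d).
Proof.
move=> Jq; set W := _ + _%:R.
have W0 : 0 <= W by rewrite addr_ge0 // mulr_ge0 // mulr_ge0 ?exprn_ge0 // ltW.
elim: d Y B => [|d IH] Y B B0 gY.
  rewrite addn0 mulr1; apply: (eq_dominated (Y [::] [::])).
    by move=> T; rewrite muln0 !sumt0 /blkprod big_ord0 mul1r.
  by rewrite -[B]mulr1; apply: (gY [::] [::]); rewrite muln0.
pose Z u v T := sumt R n (h * d) (fun I => sumt R n (h * d) (fun K =>
   blkprod R n (SPhi T) h d I K * Y (u ++ I) (v ++ K) T)).
apply: (eq_dominated (fun T => sumt R n h (fun u => sumt R n h (fun v => SPhi T u v * Z u v T)))).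
  move=> T; rewrite mulnS sumtD; apply: eq_sumt => u uh.
  under [RHS]eq_sumt do rewrite sumtD.
  rewrite [RHS]sumt_exchange; apply: eq_sumt => v vh.
  rewrite -sumtZ; apply: eq_sumt => I _; rewrite -sumtZ; apply: eq_sumt => K _.
  by rewrite blkprodS // mulrA.
rewrite addnS exprSr mulrA; apply: (@dominated_block h q J) => //.
  by rewrite mulr_ge0 ?exprn_ge0.
move=> u v uh vh; rewrite mulrAC; apply: IH; first by rewrite mulr_ge0.
move=> I K Ih Kh; rewrite -mulrA -natrM mulnb -all_cat.
by apply: gY; rewrite size_cat ?uh ?vh ?Ih ?Kh mulnS.
Qed.

End Expectation.
(** * The trace of the normalized matrix *)

Section TraceBound.
Variables (R : realType) (n k d : nat) (p : R).
Hypothesis p01 : 0 <= p <= 1.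
Let h := k./2.
Let q := (k./2 * d)%N.
Local Notation tensor := {ffun k.-tuple 'I_n -> R}.

Lemma sum_permt (I : q.-tuple 'I_n) (f : q.-tuple 'I_n -> R) :
  \sum_(s : 'S_q) f (permt s I) =
  \sum_a (#|[set s : 'S_q | permt s I == a]|)%:R * f a.
Proof.
rewrite (partition_big (fun s => permt s I) xpredT) //=; apply: eq_bigr => a _.
rewrite -sum1_card natr_sum mulr_suml; apply: eq_big => [s|s /eqP->]; first by rewrite inE.
by rewrite mul1r.
Qed.

(** The conjugate of [RPhid_norm] by the diagonal histogram matrix. All the normalization sits at
    the row index, where it compensates the number of permutations carrying [I] to a given
    arrangement. *)
Definition hist_kernel (T : tensor) (I J : q.-tuple 'I_n) : R :=
  RPhid T I J / (histfact I)%:R.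

(** Row permutations are grouped by the arrangement [a] of [I] they produce, and the column
    permutation [s] is absorbed by reindexing [J]. The result has the shape handled by
    [dominated_blocks], with [a] and [b] ranging freely. *)
Lemma hist_kernelE (T : tensor) I (X : q.-tuple 'I_n -> R) :
  \sum_J hist_kernel T I J * X J =
  \sum_(s : 'S_q) ((q`!)%:R ^+ 2)^-1 * \sum_a \sum_b SPhid T a b *
    ((#|[set t : 'S_q | permt t I == a]|)%:R / (histfact I)%:R * X (permt (s^-1)%g b)).
Proof.
rewrite -mulr_sumr.
transitivity (((q`!)%:R ^+ 2)^-1 * \sum_(s : 'S_q) \sum_J \sum_(t : 'S_q)
   SPhid T (permt t I) (permt s J) * ((histfact I)%:R^-1 * X J)).
  rewrite exchange_big mulr_sumr; apply: eq_bigr => J _.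
  rewrite /hist_kernel /RPhid -!mulrA; congr (_ * _).
  rewrite exchange_big mulr_suml; apply: eq_bigr => s _ /=.
  by rewrite mulr_suml.
congr (_ * _); apply: eq_bigr => s _; rewrite exchange_big /=.
pose f a := \sum_J SPhid T a (permt s J) * ((histfact I)%:R^-1 * X J).
rewrite -/(\sum_(t : 'S_q) f (permt t I)) (sum_permt I f).
apply: eq_bigr => a _; rewrite /f [RHS](reindex _ (onW_bij _ (permt_bij _ _ _ s))) mulr_sumr.
apply: eq_bigr => J _ /=; have -> : permt (s^-1)%g (permt s J) = J.
  by apply: eq_from_tnth => j; rewrite !tnth_mktuple permKV.
by ring.
Qed.

Variables (L : nat) (lam : R).
Hypotheses (lam0 : 0 < lam) (lam1 : lam <= 1).
Let W := lam * p * (q%:R ^+ h * n%:R ^+ h) + (2 * L)%:R.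
Local Notation dominated := (dominated R n k p L lam).

Lemma factor_ge0 : 0 <= W.
Proof.
case/andP: p01 => p0 _.
by rewrite addr_ge0 // mulr_ge0 // mulr_ge0 ?exprn_ge0 // ltW.
Qed.

(** One step of the walk. The weight of an arrangement is at most [1] by [card_perm_fiber], and [0]
    unless its letters come from [I]. The sum over the column permutations has [q!] equal bounds
    against a prefactor with [(q!)^2], leaving [1 / q!]. *)
Lemma dominated_step (X : q.-tuple 'I_n -> tensor -> R) N B : 0 <= B ->
  (forall J, dominated (X J) N B) -> forall I,
  dominated (fun T => \sum_J hist_kernel T I J * X J T) (N + d) (B * (W ^+ d / (q`!)%:R)).
Proof.
move=> B0 gX I.
pose Z s (a b : q.-tuple 'I_n) T :=
  (#|[set t : 'S_q | permt t I == a]|)%:R / (histfact I)%:R * X (permt s b) T.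
(* [Z] is extended by [0] from tuples to arbitrary sequences, as [dominated_blocks] requires. *)
pose Y s (u v : seq 'I_n) T :=
  if insub u is Some a then if insub v is Some b then Z s a b T else 0 else 0.
have Yv s (a b : q.-tuple 'I_n) T : Y s a b T = Z s a b T.
  rewrite /Y; have -> : insub (tval a) = Some a := valK a.
  by have -> : insub (tval b) = Some b := valK b.
have f0 : (q`!)%:R != 0 :> R by rewrite pnatr_eq0 -lt0n fact_gt0.
apply: (@eq_dominated _ _ _ _ _ _ (fun T => \sum_(s : 'S_q) ((q`!)%:R ^+ 2)^-1 *
  sumt R n q (fun u => sumt R n q (fun v =>
     blkprod R n (SPhi T) h d u v * Y (s^-1)%g u v T)))).
  move=> T; rewrite hist_kernelE; apply: eq_bigr => s _; congr (_ * _).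
  by apply: eq_bigr => a _; apply: eq_bigr => b _; rewrite Yv.
have -> : B * (W ^+ d / (q`!)%:R) = \sum_(s : 'S_q) ((q`!)%:R ^+ 2)^-1 * (B * W ^+ d).
  rewrite sumr_const (_ : #|_| = q`!); last by rewrite -card_Sn; apply: eq_card.
  by rewrite -[RHS]mulr_natl; field.
apply: dominated_sum => s; apply: dominatedZ => //; first by rewrite invr_ge0 exprn_ge0.
apply: (@dominated_blocks _ _ _ _ _ _ _ _ _ h q I) => //; first exact: size_tuple.
move=> u v uq vq; pose a := Tuple (introT eqP uq); pose b := Tuple (introT eqP vq).
apply: (@eq_dominated _ _ _ _ _ _ (Z (s^-1)%g a b)) => [T|]; first exact/esym/(Yv _ a b).
have hI : 0 < (histfact I)%:R :> R by rewrite ltr0n histfact_gt0.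
apply: (@dominated_le _ _ _ _ _ _ _ _ _ _
  ((#|[set t : 'S_q | permt t I == a]|)%:R / (histfact I)%:R * B)); last first.
  by apply: dominatedZ => //; rewrite divr_ge0.
rewrite mulrC ler_wpM2l // ler_pdivrMr //.
case: (boolP (all (mem I) u)) => uI /=.
  by rewrite mul1r ler_nat card_perm_fiber.
rewrite mul0r (_ : [set t | _] = finset.set0) ?cards0 //; apply/finset.setP => t; rewrite !inE.
apply/negP => /eqP tI; move/negP: uI; apply; apply/seq.allP => x xu.
by rewrite /= -(perm_mem (permt_perm _ _ t I)) tI.
- exact: lam0.
- exact: p01.
Qed.

Lemma dominated_kpow m I K :
  dominated (fun T => kpow R _ (hist_kernel T) m I K) (m * d) ((W ^+ d / (q`!)%:R) ^+ m).
Proof.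
elim: m I => [|m IH] I.
  rewrite mul0n expr0; apply: dominated_cst => //; by case: (I == K); rewrite ?lexx ?ler01.
rewrite mulSn addnC exprSr.
apply: (@dominated_step (fun J T => kpow R _ (hist_kernel T) m J K)) => //.
by rewrite exprn_ge0 // divr_ge0 // exprn_ge0 // factor_ge0.
Qed.

Lemma kpow_diag (T : tensor) m I :
  kpow R _ (@RPhid_norm R n k d T) m I I = kpow R _ (hist_kernel T) m I I.
Proof.
pose c (I : q.-tuple 'I_n) : R := Num.sqrt (histfact I)%:R.
have c0 J : c J != 0 by rewrite gt_eqF // sqrtr_gt0 ltr0n histfact_gt0.
have c2 (J : q.-tuple 'I_n) : (histfact J)%:R = c J ^+ 2 by rewrite sqr_sqrtr.
suff E J : kpow R _ (@RPhid_norm R n k d T) m I J = c I * kpow R _ (hist_kernel T) m I J / c J.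
  by rewrite E mulrAC mulfV ?mul1r.
elim: m I J => [|m IH] K J /=.
  by case: eqP => [->|]; rewrite ?mulr0 ?mul0r // mulr1 divff.
rewrite /kmul mulr_sumr mulr_suml; apply: eq_bigr => M _; rewrite IH.
rewrite /RPhid_norm -/(c K) -/(c M) [hist_kernel T K M]/hist_kernel c2.
by field; rewrite !c0.
Qed.

(** There are [n ^ q] starting points, and each walk of [2 * l] steps reads [2 * l * d] constraints,
    exactly the budget [2 * L]. The factor [lam ^- L] is the value of [phi] on the empty past. *)
Lemma trace_bound l : L = (l * d)%N ->
  Ex R n k p (fun T => \sum_I kpow R _ (@RPhid_norm R n k d T) (2 * l) I I) <=
  n%:R ^+ q * ((W ^+ d / (q`!)%:R) ^+ (2 * l) * lam ^- L).
Proof.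
move=> Ll.
rewrite Ex_sum -(sumt_cst R n q).
apply: ler_sum => I _.
have := dominated_kpow (2 * l) I I [::]; rewrite add0n Ll mulnA leqnn => /(_ isT) /andP [_].
rewrite /phi mulr1 -Ll; apply: le_trans; rewrite le_eqVlt; apply/orP; left; apply/eqP.
by apply: eq_Ex => T; rewrite big_nil mulr1 kpow_diag.
Qed.

End TraceBound.
(** * The tail bound *)

Section Estimates.
Variable R : realType.
Local Notation e := (expR 1 : R).

Lemma expR1_ge2 : 2 <= e.
Proof. by have := expR_ge1Dx (1 : R); rewrite -natr1 addrC. Qed.

(** A single term of the exponential series at [q] is at most its sum. *)
Lemma pow_le_fact_expR q : q%:R ^+ q <= (q`!)%:R * e ^+ q.
Proof.
case: q => [|q]; first by rewrite !expr0 mulr1.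
have := expR_ge1Dxn q (ler0n R q.+1).
rewrite -[X in expR X]mulr1 expRM_natl => H.
have f0 : 0 < (q.+1`!)%:R :> R by rewrite ltr0n fact_gt0.
rewrite mulrC -ler_pdivrMr //; apply: le_trans H; by rewrite lerDr.
Qed.

Lemma rising_le n q : (0 < n)%N ->
  ((q + n - 1)`!)%:R / ((n - 1)`!)%:R <= (q + n)%:R ^+ q :> R.
Proof.
move=> n0; rewrite ler_pdivrMr ?ltr0n ?fact_gt0 // -natrX -natrM ler_nat.
suff H j : (j <= q)%N -> ((j + n - 1)`! <= (q + n) ^ j * (n - 1)`!)%N by exact: H.
elim: j => [|j IH] jq; first by rewrite add0n mul1n.
have -> : (j.+1 + n - 1 = (j + n - 1).+1)%N by lia.
rewrite factS expnS -mulnA; apply: leq_mul; first by lia.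
by apply: IH; lia.
Qed.

Lemma powR_root_le (a b : R) d : (0 < d)%N -> 0 <= a -> 0 <= b -> a <= b ^+ d ->
  a `^ (d%:R^-1) <= b.
Proof.
move=> d0 a0 b0 ab; rewrite -(@ler_pXn2r _ d) ?nnegrE ?powR_ge0 //.
by rewrite -powR_mulrn ?powR_ge0 // -powRrM mulVf ?pnatr_eq0 -?lt0n // powRr1.
Qed.

Lemma pow2_between (x : R) : 1 / 2 <= x ->
  exists r : nat, x <= (2 ^ r)%:R /\ (2 ^ r)%:R <= 2 * x.
Proof.
move=> x12.
have ex : exists r : nat, x <= (2 ^ r)%:R.
  exists (Num.bound x); apply: le_trans (ltW (archi_boundP _)) _; first by lra.
  by rewrite ler_nat ltnW // ltn_expl.
case: (ex_minnP ex) => r xr rmin; exists r; split => //.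
(* At [r = 0] the power is [1], which is at most [2 * x] by the lower bound on [x]. *)
case: r xr rmin => [|r] xr rmin; first by rewrite expn0; lra.
rewrite expnS natrM ler_wpM2l // leNgt; apply/negP => /ltW /rmin; by rewrite ltnn.
Qed.

Lemma ln_ge_half n : (2 <= n)%N -> 1 / 2 <= ln n%:R :> R.
Proof.
move=> n2; have n0 : 0 < n%:R :> R by rewrite ltr0n; lia.
have : ln (n%:R^-1) <= n%:R^-1 - 1 :> R.
  have := @le_ln1Dx R (n%:R^-1 - 1).
  rewrite addrCA subrr addr0; apply; by rewrite ltrBrDr addrC subrr invr_gt0.
rewrite lnV ?posrE // => H.
have : n%:R^-1 <= 2^-1 :> R by rewrite lef_pV2 ?posrE // ler_nat.
by move: H; set a := n%:R^-1; lra.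
Qed.

Lemma expRN_le (x : R) : 0 < x -> expR (- x) <= x^-1.
Proof.
move=> x0; rewrite expRN lef_pV2 ?posrE ?expR_gt0 //.
by apply: le_trans (expR_ge1Dx x); lra.
Qed.

End Estimates.

(** * Markov's inequality and the lower tail of the number of constraints *)

Section Concentration.
Variables (R : realType) (n k : nat) (p : R).
Hypothesis p01 : 0 <= p <= 1.
Local Notation tensor := {ffun k.-tuple 'I_n -> R}.

(** Markov's inequality, for a nonnegative [Y] that is at least [1] whenever [E] fails. *)
Lemma Prob_ge (E : tensor -> bool) (Y : tensor -> R) :
  (forall T, 0 <= Y T) -> (forall T, ~~ E T -> 1 <= Y T) ->
  1 - Ex R n k p Y <= Prob p E.
Proof.
move=> Y0 EY; rewrite -(@Ex_cst R n k p 1) -mulN1r -ExZ -ExD.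
rewrite -[Prob p E]/(Ex R n k p (fun T => (E T)%:R)).
apply: (@Ex_le _ _ _ _ p01) => w; case: (boolP (E _)) => [_|/EY] /=; last by lra.
by have := Y0 (tensor_of R w); lra.
Qed.

(** The Chernoff computation: each tuple contributes a factor [1 - p + p / e], at most [1 - p / 2]
    since [e] is at least [2], hence at most [expR (- (p / 2))]. *)
Lemma Ex_exp_nconstr :
  Ex R n k p (fun T => expR (- (nconstr T)%:R)) <= expR (- (p * n%:R ^+ k / 2)).
Proof.
have [p0 p1] := andP p01.
pose g (o : option bool) : R := if o is Some _ then expR (-1) else 1.
have -> : Ex R n k p (fun T => expR (- (nconstr T)%:R)) =
    \prod_(S : k.-tuple 'I_n) ((1 - p) * g None + p / 2 * (g (Some true) + g (Some false))).
  have := @Ex_prod R n k p (fun _ o => g o) => <-.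
  apply: eq_bigr => w _; congr (_ * _).
  rewrite -mulrN1 expRM_natl /nconstr -prodr_const big_mkcond /=.
  apply: eq_bigr => S _; rewrite inE ffunE.
  by case: (w S) => [[]|]; rewrite ?eqxx ?oppr_eq0 ?oner_eq0.
rewrite prodr_const card_tuple card_ord.
have -> : expR (- (p * n%:R ^+ k / 2)) = expR (- (p / 2)) ^+ (n ^ k).
  by rewrite -expRM_natl natrX; congr expR; ring.
apply: lerXn2r; rewrite ?nnegrE ?expR_ge0 //.
  have : 0 <= p * expR (-1) by rewrite mulr_ge0 ?expR_ge0.
  rewrite /g; lra.
rewrite /g; apply: le_trans (expR_ge1Dx _).
have e2 : expR (-1) <= 2^-1 :> R.
  rewrite expRN lef_pV2 ?posrE ?expR_gt0 //; exact: expR1_ge2.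
have : p * expR (-1) <= p * 2^-1 by rewrite ler_wpM2l.
lra.
Qed.

End Concentration.

(** * Choice of parameters and the explicit probability bound *)

Section Refutation.
Variables (R : realType) (n k d : nat) (p : R).
Hypotheses (d0 : (0 < d)%N) (dn : (d <= n)%N) (k0 : (0 < k)%N) (even_k : ~~ odd k).
Hypotheses (p01 : 0 <= p <= 1) (n2 : (2 <= n)%N).
Hypothesis dense : 1 < p * d%:R ^+ (k./2 - 1) * n%:R ^+ k./2.
Let h := k./2.
Let q := (k./2 * d)%N.
Local Notation e := (expR 1 : R).
Let P : R := p * n%:R ^+ h.
Let V : R := ln n%:R / Num.sqrt (d%:R ^+ (h - 1) * n%:R ^+ h * p)
  * (expR (3 * k%:R / 4) / ((k%:R / 2) `^ (k%:R / 4))).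
(** [s ^+ d] is the threshold for the spectral norm. The [8] comes from the squares of
    [1 + 2 * l <= 4 * l] and [l <= 2 * ln n], as [64 = 16 * 4]. *)
Let s : R := 8 * e * V * P.
Local Notation tensor := {ffun k.-tuple 'I_n -> R}.

Let h0 : (0 < h)%N.
Proof. by rewrite /h; move: k0 even_k; case: k => [|[]]. Qed.

Let hS : (h - 1).+1 = h. Proof. by rewrite subn1 prednK. Qed.
Let n0 : (0 < n)%N. Proof. exact: ltnW n2. Qed.

Let kE : k%:R = 2 * h%:R :> R.
Proof. by rewrite -(addhh k even_k) natrD; ring. Qed.

Let dpos : 0 < d%:R :> R. Proof. by rewrite ltr0n. Qed.
Let hpos : 0 < h%:R :> R. Proof. by rewrite ltr0n. Qed.
Let npos : 0 < n%:R :> R. Proof. by rewrite ltr0n. Qed.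
Let epos : 0 < e. Proof. exact: expR_gt0. Qed.

Let Pd : 1 < P * d%:R ^+ (h - 1).
Proof. by have := dense; rewrite mulrAC. Qed.

Let P0 : 0 < P.
Proof. by rewrite -(@pmulr_lgt0 _ (d%:R ^+ (h - 1))) ?exprn_gt0 // (lt_trans ltr01). Qed.

Let lnn : 1 / 2 <= ln n%:R :> R. Proof. exact: ln_ge_half. Qed.

(** [V] carries the part of the rate due to the spectral norm; the remaining factor comes from the
    rising factorial in [sathat]. *)
Lemma bound_iiE : bound_ii n k d p = V * (h%:R + 1) ^+ h.
Proof.
rewrite /bound_ii /V -/h; have -> : k%:R / 2 = h%:R :> R by rewrite kE; field.
by ring.
Qed.

Lemma bound_ii_sqr : V ^+ 2 =
  ln n%:R ^+ 2 * e ^+ (3 * h) / (d%:R ^+ (h - 1) * P * h%:R ^+ h).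
Proof.
have -> : V ^+ 2 = ln n%:R ^+ 2 / Num.sqrt (d%:R ^+ (h - 1) * n%:R ^+ h * p) ^+ 2 *
    (expR (3 * k%:R / 4) ^+ 2 / ((k%:R / 2) `^ (k%:R / 4)) ^+ 2).
  by rewrite /V !exprMn !exprVn.
have -> : d%:R ^+ (h - 1) * n%:R ^+ h * p = d%:R ^+ (h - 1) * P by rewrite /P; ring.
rewrite sqr_sqrtr; last by rewrite mulr_ge0 ?exprn_ge0 // ltW.
have -> : expR (3 * k%:R / 4) ^+ 2 = e ^+ (3 * h) :> R.
  by rewrite -!expRM_natl natrM kE; congr expR; field.
have -> : ((k%:R / 2) `^ (k%:R / 4)) ^+ 2 = h%:R ^+ h :> R.
  rewrite -powR_mulrn ?powR_ge0 // -powRrM.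
  have -> : k%:R / 4 * 2 = h%:R :> R by rewrite kE; field.
  have -> : k%:R / 2 = h%:R :> R by rewrite kE; field.
  by rewrite powR_mulrn.
have d1 : d%:R ^+ (h - 1) != 0 :> R by rewrite expf_neq0 ?gt_eqF.
have hh : h%:R ^+ h != 0 :> R by rewrite expf_neq0 ?gt_eqF.
by field; rewrite d1 hh (gt_eqF P0).
Qed.

Lemma V_gt0 : 0 < V.
Proof.
rewrite /V mulr_gt0 ?divr_gt0 ?expR_gt0 ?powR_gt0 //.
- by apply: lt_le_trans lnn; lra.
- by rewrite sqrtr_gt0 -mulrA [_ * p]mulrC -/P mulr_gt0 ?exprn_gt0.
- by rewrite kE; move: hpos; lra.
Qed.

Lemma s_gt0 : 0 < s. Proof. by apply: mulr_gt0 P0; apply: mulr_gt0 V_gt0; apply: mulr_gt0. Qed.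

Let x : R := p * (q%:R ^+ h * n%:R ^+ h).

Let qh : q%:R ^+ h = h%:R ^+ h * (d%:R * d%:R ^+ (h - 1)) :> R.
Proof.
rewrite /q -/h natrM exprMn; congr (_ * _); by rewrite -exprS hS.
Qed.

(** The left side is the base of the [(l * d)]-th power to which the trace bound is reduced; both
    sides are explicit multiples of the same quantity [A]. *)
Lemma s_sqr_ge (l : nat) : l%:R <= 2 * ln n%:R :> R ->
  e ^+ (h + 1) * (e / q%:R) ^+ (2 * h) * (16 * l%:R ^+ 2 * d%:R * x) <= s ^+ 2.
Proof.
move=> l2.
have d1 : d%:R ^+ (h - 1) != 0 :> R by rewrite expf_neq0 ?gt_eqF.
have hh : h%:R ^+ h != 0 :> R by rewrite expf_neq0 ?gt_eqF.
pose A := e ^+ (3 * h) * P / (d%:R ^+ (h - 1) * h%:R ^+ h).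
have A0 : 0 < A by apply: divr_gt0; apply: mulr_gt0; rewrite ?exprn_gt0.
have -> : s ^+ 2 = 64 * e ^+ 2 * ln n%:R ^+ 2 * A.
  have -> : s ^+ 2 = (8 * e) ^+ 2 * V ^+ 2 * P ^+ 2 by rewrite /s; ring.
  rewrite bound_ii_sqr /A.
  field; rewrite d1 hh (gt_eqF P0) //.
have -> : e ^+ (h + 1) * (e / q%:R) ^+ (2 * h) * (16 * l%:R ^+ 2 * d%:R * x) =
    16 * e * l%:R ^+ 2 * A.
  rewrite exprMn exprVn mul2n -addnn exprD [q%:R ^+ (h + h)]exprD /x qh /A /P.
  rewrite [(3 * h)%N]mulnC exprM exprD expr1.
  field; rewrite d1 hh (gt_eqF dpos) //.
apply: (ler_wpM2r (ltW A0)).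
have l4 : l%:R ^+ 2 <= 4 * ln n%:R ^+ 2 :> R.
  have -> : 4 * ln n%:R ^+ 2 = (2 * ln n%:R) ^+ 2 :> R by ring.
  by rewrite lerXn2r ?nnegrE //; move: lnn; lra.
have e1 : 1 <= e by apply: le_trans (expR1_ge2 R); lra.
have : 16 * e * l%:R ^+ 2 <= 16 * e * (4 * ln n%:R ^+ 2).
  by rewrite ler_wpM2l // mulr_ge0 // ltW.
move=> H; apply: le_trans H _.
have -> : 64 * e ^+ 2 * ln n%:R ^+ 2 = e * (16 * e * (4 * ln n%:R ^+ 2)) by ring.
rewrite ler_peMl //; apply: mulr_ge0; last by rewrite mulr_ge0 ?sqr_ge0.
by apply: mulr_ge0 => //; exact: ltW.
Qed.

(** The density hypothesis enters here, to make [lam = d / x] at most [1]. *)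
Lemma x_ge_d : d%:R <= x.
Proof.
have -> : x = h%:R ^+ h * d%:R * (P * d%:R ^+ (h - 1)) by rewrite /x qh /P; ring.
rewrite mulrAC -[X in X <= _]mul1r; apply: (ler_wpM2r (ltW dpos)); apply: ltW.
rewrite -[X in X < _]mulr1; apply: le_lt_trans (_ : h%:R ^+ h * 1 < _).
  by rewrite ler_wpM2r // exprn_ege1 // ler1n.
by rewrite ltr_pM2l // exprn_gt0.
Qed.

(** After multiplication by [n], the trace bound is at most an [(l * d)]-th power, whose base is
    compared with [s ^+ 2]. The gain [1 / n] becomes the failure probability. *)
Lemma trace_le_pow (l : nat) : (0 < l)%N -> ln n%:R <= l%:R :> R -> l%:R <= 2 * ln n%:R :> R ->
  Ex R n k p (fun T => \sum_I kpow R _ (@RPhid_norm R n k d T) (2 * l) I I) <=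
  (s ^+ d) ^+ (2 * l) / n%:R.
Proof.
move=> l0 nl l2; rewrite ler_pdivlMr //.
have x0 : 0 < x by apply: lt_le_trans x_ge_d.
pose lam := d%:R / x.
have lam0 : 0 < lam by rewrite divr_gt0.
have lam1 : lam <= 1 by rewrite ler_pdivrMr // mul1r x_ge_d.
have := @trace_bound R n k d p p01 (l * d) lam lam0 lam1 l erefl.
rewrite -/h -/q; set W := lam * p * _ + _ => H.
have W0 : 0 <= W by exact: (factor_ge0 R n k d p p01 (l * d) lam lam0).
have WE : W = (1 + 2 * l%:R) * d%:R.
  rewrite /W -mulrA -/x /lam divfK ?gt_eqF // !natrM; ring.
have l1 : 1 <= l%:R :> R by rewrite ler1n.
have Wd : W ^+ 2 * (x / d%:R) <= 16 * l%:R ^+ 2 * d%:R * x.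
  have -> : W ^+ 2 * (x / d%:R) = (1 + 2 * l%:R) ^+ 2 * (d%:R * x).
    by rewrite WE; field; rewrite gt_eqF.
  rewrite -[X in _ <= X]mulrA; apply: ler_wpM2r; first by rewrite mulr_ge0 // ltW.
  have -> : 16 * l%:R ^+ 2 = (4 * l%:R) ^+ 2 :> R by ring.
  by rewrite lerXn2r ?nnegrE ?addr_ge0 //; lra.
have fq : (q`!)%:R^-1 <= (e / q%:R) ^+ q.
  have q0 : 0 < q%:R ^+ q :> R by rewrite exprn_gt0 // ltr0n muln_gt0 h0.
  rewrite expr_div_n ler_pdivlMr // mulrC ler_pdivrMr ?ltr0n ?fact_gt0 // mulrC.
  exact: pow_le_fact_expR.
(* Since [n <= e ^+ l], the number of starting points and the extra [n] cost only a constant per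
   block: [q + 1 <= (h + 1) * d]. *)
have nq : n%:R ^+ q * n%:R <= (e ^+ (h + 1)) ^+ (l * d).
  rewrite -exprSr; have nel : n%:R <= e ^+ l.
    by rewrite -expRM_natl mulr1 -[X in X <= _](@lnK R) ?posrE // ler_expR.
  apply: le_trans (_ : (e ^+ l) ^+ q.+1 <= _).
    by rewrite lerXn2r ?nnegrE ?exprn_ge0 // ltW.
  rewrite -!exprM ler_weXn2l //; first by apply: le_trans (expR1_ge2 R); lra.
  rewrite mulnCA leq_mul2l mulnDl mul1n -[(h * d)%N]/q.
  by rewrite -addn1 leq_add2l d0 orbT.
have eq0 : 0 <= e / q%:R by rewrite divr_ge0 // ltW.
have B0 : 0 <= 16 * l%:R ^+ 2 * d%:R * x.
  by apply: mulr_ge0 (ltW x0); rewrite !mulr_ge0 ?exprn_ge0.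
have xd0 : 0 <= x / d%:R by apply: divr_ge0 => //; exact: ltW.
have Wx0 : 0 <= W ^+ 2 * (x / d%:R) by apply: mulr_ge0 xd0; exact: sqr_ge0.
apply: le_trans (_ : ((e ^+ (h + 1) * (e / q%:R) ^+ (2 * h) *
    (16 * l%:R ^+ 2 * d%:R * x)) ^+ (l * d)) <= _); last first.
  have -> : (s ^+ d) ^+ (2 * l) = (s ^+ 2) ^+ (l * d).
    by rewrite -!exprM mulnCA [(d * l)%N]mulnC.
  rewrite lerXn2r ?nnegrE ?sqr_ge0 ?s_sqr_ge //.
  by apply: mulr_ge0 B0; apply: mulr_ge0; rewrite exprn_ge0 // ltW.
apply: le_trans (ler_wpM2r (ltW npos) H) _.
have -> : (W ^+ d / (q`!)%:R) ^+ (2 * l) * lam ^- (l * d) =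
   ((q`!)%:R^-1) ^+ (2 * l) * (W ^+ 2 * (x / d%:R)) ^+ (l * d).
  rewrite -exprVn /lam invf_div exprMn [in RHS]exprMn mulrA; congr (_ * _).
  by rewrite mulrC -[in LHS]exprM -[in RHS]exprM (mulnCA d) (mulnC d l).
rewrite mulrAC -[X in _ <= X ^+ _]mulrA [X in _ <= X]exprMn.
apply: ler_pM nq _; first by rewrite mulr_ge0 ?exprn_ge0.
  by apply: mulr_ge0; rewrite ?exprn_ge0 ?invr_ge0.
rewrite [X in _ <= X]exprMn; apply: ler_pM.
- by rewrite exprn_ge0 ?invr_ge0.
- by rewrite exprn_ge0.
- have hq : (2 * h * (l * d) = q * (2 * l))%N by rewrite mulnACA mulnC.
  rewrite -exprM hq [X in _ <= X]exprM.
  by rewrite lerXn2r ?nnegrE ?invr_ge0 ?exprn_ge0.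
- by rewrite lerXn2r ?nnegrE.
Qed.

(** The three factors of [sathat] are bounded separately. The lower bound on the number of
    constraints gives a [2], which with the [8] in [s] makes [16]; the rising factorial is at most
    [(q + n) ^ q], and [q + n <= n * (h + 1)] because [d <= n]. *)
Lemma sathat_le (T : tensor) : spec_norm (@RPhid_norm R n k d T) <= s ^+ d ->
  p * n%:R ^+ k / 4 <= (nconstr T)%:R ->
  sathat d T - 1 / 2 <= 16 * e * bound_ii n k d p.
Proof.
move=> Ts mT; rewrite /sathat addrAC subrr add0r bound_iiE.
have -> : 16 * e * (V * (h%:R + 1) ^+ h) =
    2 * (P * n%:R ^+ h)^-1 * s * (n%:R * (h%:R + 1)) ^+ h.
  rewrite /s exprMn; field; by rewrite expf_neq0 ?gt_eqF.
have mu : p * n%:R ^+ k = P * n%:R ^+ h by rewrite -[in LHS](addhh k even_k) exprD mulrA.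
have mu0 : 0 < P * n%:R ^+ h by rewrite mulr_gt0 ?exprn_gt0.
rewrite mu in mT.
have i0 : 0 <= (2 * (nconstr T)%:R)^-1 :> R by rewrite invr_ge0 mulr_ge0.
apply: ler_pM; rewrite ?powR_ge0 //; first by rewrite mulr_ge0 ?powR_ge0.
  apply: ler_pM; rewrite ?powR_ge0 //.
    have m0 : 0 < (nconstr T)%:R :> R by apply: lt_le_trans mT; rewrite divr_gt0.
    move: mT m0 mu0; set m := (nconstr T)%:R; set y := P * n%:R ^+ h => mT m0 mu0.
    rewrite ler_pdivlMr // ler_pdivrMl ?mulr_gt0 //; lra.
  by apply: powR_root_le; rewrite ?spec_norm_ge0 // ltW ?s_gt0.
apply: powR_root_le; rewrite ?divr_ge0 ?exprn_ge0 ?mulr_ge0 ?addr_ge0 //.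
apply: le_trans (rising_le _ n q n0) _.
rewrite -exprM -/h -/q lerXn2r ?nnegrE ?mulr_ge0 ?addr_ge0 //.
by rewrite natr1 -natrM ler_nat mulnS addnC leq_add2l mulnC leq_mul.
Qed.

Lemma Prob_sathat_le :
  1 - 5 / n%:R <= Prob p (fun T : tensor => sathat d T - 1 / 2 <= 16 * e * bound_ii n k d p).
Proof.
have [r [nl l2]] := pow2_between R _ lnn; set l := (2 ^ r)%N in nl l2.
have l0 : (0 < l)%N by rewrite expn_gt0.
pose mu := p * n%:R ^+ k.
have sd0 : 0 < (s ^+ d) ^+ (2 * l) by rewrite !exprn_gt0 ?s_gt0.
(* One summand is at least [1] when the norm exceeds its threshold, the other when fewer than
   [mu / 4] constraints are present. Their means are at most [1 / n] and [4 / n], whence the [5]. *)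
pose Y (T : tensor) := ((s ^+ d) ^+ (2 * l))^-1 * spec_norm (@RPhid_norm R n k d T) ^+ (2 * l)
  + expR (mu / 4) * expR (- (nconstr T)%:R).
have EY : Ex R n k p Y <= 5 / n%:R.
  rewrite ExD !ExZ.
  (* Density together with [d <= n] gives [1 <= P * n ^ (h - 1)]; the Chernoff term
     [expR (- (mu / 4))] is then at most [4 / mu <= 4 / n]. *)
  have mun : n%:R <= mu.
    rewrite /mu -(addhh k even_k) exprD -/h mulrA -/P.
    have -> : n%:R ^+ h = n%:R ^+ (h - 1) * n%:R :> R by rewrite -exprSr hS.
    rewrite mulrA -[X in X <= _]mul1r; apply: (ler_wpM2r (ltW npos)).
    apply: le_trans (ltW Pd) _; apply: (ler_wpM2l (ltW P0)).
    by rewrite lerXn2r ?nnegrE // ler_nat.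
  have H1 : ((s ^+ d) ^+ (2 * l))^-1 *
     Ex R n k p (fun T => spec_norm (@RPhid_norm R n k d T) ^+ (2 * l)) <= n%:R^-1.
    rewrite mulrC ler_pdivrMr // mulrC.
    apply: le_trans (trace_le_pow l l0 nl l2).
    apply: (@Ex_le _ _ _ _ p01) => w; rewrite /l -expnS.
    by apply: spec_norm_trace => I J; exact: RPhid_norm_sym.
  have H2 : expR (mu / 4) * Ex R n k p (fun T => expR (- (nconstr T)%:R)) <= 4 / n%:R.
    apply: le_trans (ler_wpM2l (expR_ge0 _) (Ex_exp_nconstr R n k p p01)) _.
    rewrite -expRD -/mu (_ : mu / 4 + - (mu / 2) = - (mu / 4)); last by field.
    have mu0 : 0 < mu by apply: lt_le_trans mun.
    apply: le_trans (expRN_le R _ _) _; first by rewrite divr_gt0.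
    by rewrite invf_div ler_wpM2l // lef_pV2 ?posrE.
  apply: le_trans (lerD H1 H2) _; rewrite -[X in X + _]mul1r -mulrDl.
  apply: ler_wpM2r; [by rewrite invr_ge0 ltW | by lra].
apply: le_trans (Prob_ge R n k p p01 _ Y _ _); first by rewrite lerD2l lerN2.
  move=> T; rewrite addr_ge0 ?mulr_ge0 ?expR_ge0 ?invr_ge0 ?exprn_ge0 ?spec_norm_ge0 //.
  by rewrite ltW ?s_gt0.
move=> T; apply: contraR; rewrite -ltNge => Y1; apply: sathat_le.
  rewrite leNgt; apply/negP => sT; move: Y1; rewrite ltNge => /negP; apply.
  rewrite -[X in X <= _]addr0; apply: lerD; last by rewrite mulr_ge0 ?expR_ge0.
  rewrite mulrC ler_pdivlMr // mul1r lerXn2r ?nnegrE ?spec_norm_ge0 ?exprn_ge0 ?ltW ?s_gt0 //.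
rewrite leNgt; apply/negP => sT; move: Y1; rewrite ltNge => /negP; apply.
rewrite -[X in X <= _]add0r; apply: lerD.
  by rewrite mulr_ge0 ?invr_ge0 ?exprn_ge0 ?spec_norm_ge0 // ltW ?s_gt0.
by rewrite -expRD -[X in X <= _]expR0 ler_expR subr_ge0 ltW.
Qed.

End Refutation.

(** * From the tail bound to the asymptotic statement *)

Lemma Prob_ge0 (R : realType) (n k : nat) (p : R) (E : {ffun k.-tuple 'I_n -> R} -> bool) :
  0 <= p <= 1 -> 0 <= Prob p E.
Proof. by move=> p01; apply: sumr_ge0 => w _; rewrite mulr_ge0 // weight_ge0. Qed.

Lemma le_Prob (R : realType) (n k : nat) (p : R) (E F : {ffun k.-tuple 'I_n -> R} -> bool) :
  0 <= p <= 1 -> (forall T, E T -> F T) -> Prob p E <= Prob p F.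
Proof.
move=> p01 EF; rewrite -[Prob p E]/(Ex R n k p (fun T => (E T)%:R)) -[Prob p F]/(Ex R n k p (fun T => (F T)%:R)).
apply: (@Ex_le _ _ _ _ p01) => w.
by rewrite ler_nat; case: (E _) (EF (tensor_of R w)) => //= ->.
Qed.

Lemma Prob_sathat_le_bound_ii (R : realType) (n k d : nat) (p : R) :
  (0 < d)%N -> (d <= n)%N -> (0 < k)%N -> ~~ odd k -> 0 <= p <= 1 ->
  1 < p * (d%:R) ^+ (k./2 - 1) * (n%:R) ^+ k./2 ->
  1 - 5 / n%:R <= Prob (n:=n) (k:=k) p
    (fun T => sathat d T - 1 / 2 <= 16 * expR 1 * bound_ii n k d p).
Proof.
move=> d0 dn k0 ek p01 dense; have [n2|n1] := leqP 2 n; first exact: Prob_sathat_le.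
(* For [n = 1] the lower bound [1 - 5 / n] is negative. *)
have -> : n = 1%N by lia.
by apply: le_trans (Prob_ge0 _ _ _ _ _ p01); lra.
Qed.

(* [p d^(k/2-1) n^(k/2) = n^(k-1) p / (n/d)^(k/2-1)] is eventually at least [M log^2 n]
   for every [M], and the bound of part (ii) is then at most a constant over [sqrt M]. *)
Lemma Prob_sathat_le_eps (R : realType) (k : nat) (d : nat -> nat) (p : nat -> R) :
  (0 < k)%N -> ~~ odd k ->
  (forall n, (0 < n)%N -> (0 < d n)%N /\ (d n <= n)%N) ->
  (forall n, 0 <= p n <= 1) ->
  (forall M : R, exists N : nat, forall n : nat, (N <= n)%N ->
     M * ((n%:R / (d n)%:R) ^+ (k./2 - 1) * (ln n%:R) ^+ 2)
       <= (n%:R) ^+ (k - 1) * p n) ->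
  forall eps delta : R, 0 < eps -> 0 < delta ->
  exists N : nat, forall n : nat, (N <= n)%N ->
    1 - delta <= Prob (n:=n) (k:=k) (p n) (fun T => sathat (d n) T - 1 / 2 <= eps).
Proof.
move=> k0 ek dP p01 omega eps delta eps0 delta0; set h := k./2.
have h0 : (0 < h)%N by rewrite /h; case: (k) k0 ek => [|[]].
have kh : (h + h = k)%N by exact: addhh.
pose K : R := 16 * expR 1 *
  (expR (3 * k%:R / 4) * (k%:R / 2 + 1) ^+ h / ((k%:R / 2) `^ (k%:R / 4))).
have k20 : 0 < k%:R / 2 :> R by rewrite divr_gt0 // ltr0n.
have K0 : 0 < K.
  by rewrite !mulr_gt0 ?invr_gt0 ?expR_gt0 ?powR_gt0 // exprn_gt0 // addr_gt0.
(* The square makes [K / Num.sqrt M] at most [eps]; the [5] ensures [1 < D], as [ln n ^ 2] is at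
   least [1 / 4]. *)
pose M : R := 5 + (K / eps) ^+ 2.
have M5 : 5 <= M by rewrite lerDl sqr_ge0.
have [N HN] := omega M.
exists (maxn N (maxn 2 (Num.bound (5 / delta)))) => n.
rewrite !geq_max => /and3P [Nn n2 nb].
have n0 : (0 < n)%N by lia.
have npos : 0 < n%:R :> R by rewrite ltr0n.
have [d0 dn] := dP n n0.
have dpos : 0 < (d n)%:R :> R by rewrite ltr0n.
have lnn := ln_ge_half R n n2.
have ln2 : 1 / 4 <= ln n%:R ^+ 2 :> R.
  have -> : 1 / 4 = (1 / 2) ^+ 2 :> R by field.
  by rewrite lerXn2r ?nnegrE //; lra.
pose D := (d n)%:R ^+ (h - 1) * n%:R ^+ h * p n.
have DM : M * ln n%:R ^+ 2 <= D.
  have r0 : 0 < (n%:R / (d n)%:R) ^+ (h - 1) :> R by rewrite exprn_gt0 // divr_gt0.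
  rewrite -(ler_pM2l r0); apply: le_trans (_ : _ <= n%:R ^+ (k - 1) * p n) _.
    by have := HN n Nn; rewrite -/h; rewrite mulrCA.
  have -> : n%:R ^+ (k - 1) = n%:R ^+ (h - 1) * n%:R ^+ h :> R.
    by rewrite -exprD -kh addnBAC.
  rewrite /D expr_div_n le_eqVlt; apply/orP; left; apply/eqP.
  by field; rewrite expf_neq0 // gt_eqF.
have D1 : 1 < D.
  apply: lt_le_trans DM; apply: lt_le_trans (_ : 5 * (1 / 4) <= _); first by lra.
  by apply: ler_pM => //; lra.
have D0 : 0 < D by apply: lt_trans D1.
have := @Prob_sathat_le_bound_ii R n k (d n) (p n) d0 dn k0 ek (p01 n).
rewrite (_ : _ * _ * _ = D) => [/(_ D1) H|]; last by rewrite /D -/h; ring.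
apply: le_trans (_ : 1 - 5 / n%:R <= _).
  rewrite lerD2l lerN2 ler_pdivrMr // mulrC -ler_pdivrMr //.
  apply: ltW; apply: lt_le_trans (_ : (Num.bound (5 / delta))%:R <= _).
    by apply: archi_boundP; rewrite divr_ge0 // ltW.
  by rewrite ler_nat.
apply: le_trans H _; apply: le_Prob => // T /le_trans; apply.
have -> : 16 * expR 1 * bound_ii n k (d n) (p n) = K * (ln n%:R / Num.sqrt D).
  by rewrite /bound_ii /K -/h -/D; ring.
have KM : K / eps <= Num.sqrt M.
  have Ke : 0 <= K / eps by rewrite ltW // divr_gt0.
  rewrite -(@ler_pXn2r _ 2) ?nnegrE ?sqrtr_ge0 // sqr_sqrtr; first by rewrite /M lerDr.
  by apply: le_trans M5.
have lnD : ln n%:R * Num.sqrt M <= Num.sqrt D.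
  have l0 : 0 <= ln n%:R :> R by lra.
  rewrite -[ln _](ger0_norm l0) -sqrtr_sqr -sqrtrM ?sqr_ge0 // ler_wsqrtr //.
  by rewrite mulrC.
rewrite mulrA ler_pdivrMr ?sqrtr_gt0 //.
apply: le_trans (_ : eps * (ln n%:R * Num.sqrt M) <= _); last first.
  by apply: ler_wpM2l lnD; exact: ltW.
rewrite mulrCA [K * _]mulrC; apply: ler_wpM2l; first by lra.
by rewrite mulrC -ler_pdivrMr.
Qed.

Theorem mainTheorem9 (R : realType) :
  (* (i) *)
  (forall (n k d : nat) (T : {ffun k.-tuple 'I_n -> R}) (x : 'I_n -> R),
     (0 < d)%N -> (d <= n)%N -> (0 < k)%N -> ~~ odd k ->
     is_instance T -> (0 < nconstr T)%N ->
     (forall i, x i = 1 \/ x i = -1) ->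
     `|sat T x - 1 / 2| <= sathat d T - 1 / 2)
  /\
  (* (ii) *)
  (exists c C : R, 0 < c /\ 0 < C /\
     forall (n k d : nat) (p : R),
     (0 < d)%N -> (d <= n)%N -> (0 < k)%N -> ~~ odd k ->
     0 <= p <= 1 ->
     1 < p * (d%:R) ^+ (k./2 - 1) * (n%:R) ^+ k./2 ->
     Prob (n:=n) (k:=k) p (fun T => sathat d T - 1 / 2 <= c * bound_ii n k d p)
       >= 1 - C / n%:R)
  /\
  (* "in particular": fixed k, n^{k-1} p = omega((n/d)^{k/2-1} log^2 n)
     implies sathat = 1/2 + o(1) with high probability *)
  (forall (k : nat) (d : nat -> nat) (p : nat -> R),
     (0 < k)%N -> ~~ odd k ->
     (forall n, (0 < n)%N -> (0 < d n)%N /\ (d n <= n)%N) ->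
     (forall n, 0 <= p n <= 1) ->
     (forall M : R, exists N : nat, forall n : nat, (N <= n)%N ->
        M * ((n%:R / (d n)%:R) ^+ (k./2 - 1) * (ln n%:R) ^+ 2)
          <= (n%:R) ^+ (k - 1) * p n) ->
     forall eps delta : R, 0 < eps -> 0 < delta ->
     exists N : nat, forall n : nat, (N <= n)%N ->
       Prob (n:=n) (k:=k) (p n) (fun T => sathat (d n) T - 1 / 2 <= eps) >= 1 - delta).
Proof.
split; last split.
- by move=> n k d T x d0 dn k0 ek iT m0 x1; exact: sat_dist_le_sathat.
- exists (16 * expR 1), 5; split; first by rewrite mulr_gt0 ?expR_gt0.
  by split=> // n k d p d0 dn k0 ek p01 dense; exact: Prob_sathat_le_bound_ii.
- by move=> k d p k0 ek dP p01 omega eps delta; exact: Prob_sathat_le_eps.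
Qed.
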